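(* Let $F$ be a function which is analytic in a complex neighborhood of the real line $\mathbb R$, and suppose that $F$ is locally injective on $\mathbb R$. If the set of self-intersections $$\{(a,b)\in\mathbb R^2:\ a\ne b\text{ and }F(a)=F(b)\}$$ is uncountable, then $F(\mathbb R)$ is a loop in $\mathbb C$.
   Context: $F$ is locally injective on $\mathbb R$ if for every $t\in\mathbb R$ there is an open real interval containing $t$ on which (the restriction to real arguments of) $F$ is one-to-one. A loop in $\mathbb C$ is the image of a continuous map $L:[\gamma,\delta]\to\mathbb C$ (with $\gamma<\delta$ real) such that $L(\gamma)=L(\delta)$. *)

(* Defs.v *)
From Stdlib Require Import Reals.
From Coquelicot Require Import Coquelicot.
Open Scope R_scope.

Definition analytic_on (U : C -> Prop) (F : C -> C) : Prop :=
  forall z, U z ->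
    exists r : R, 0 < r /\
    exists a : nat -> C,
      forall w : C, Cmod (Cminus w z) < r -> is_pseries a (Cminus w z) (F w).

Definition analytic_near_real_line (F : C -> C) : Prop :=
  exists U : C -> Prop, open U /\ (forall t : R, U (RtoC t)) /\ analytic_on U F.

Definition locally_injective_on_R (F : C -> C) : Prop :=
  forall t : R, exists a b : R, a < t < b /\
    forall x y : R, a < x < b -> a < y < b ->
      F (RtoC x) = F (RtoC y) -> x = y.

Definition countable_set {T : Type} (S : T -> Prop) : Prop :=
  exists f : nat -> T, forall p, S p -> exists n, f n = p.

Definition self_intersections (F : C -> C) : R * R -> Prop :=
  fun p => fst p <> snd p /\ F (RtoC (fst p)) = F (RtoC (snd p)).

Definition continuous_on_interval (L : R -> C) (g d : R) : Prop :=
  forall s, g <= s <= d -> forall eps : R, 0 < eps ->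
    exists del : R, 0 < del /\
      forall s', g <= s' <= d -> Rabs (s' - s) < del ->
        Cmod (Cminus (L s') (L s)) < eps.

Definition is_loop (A : C -> Prop) : Prop :=
  exists (g d : R) (L : R -> C),
    g < d /\ continuous_on_interval L g d /\ L g = L d /\
    forall w : C, A w <-> exists s, g <= s <= d /\ L s = w.

Definition image_of_R (F : C -> C) : C -> Prop :=
  fun w => exists t : R, F (RtoC t) = w.

(* Main.v *)
Require Import Defs.
From Stdlib Require Import Reals Lra Lia Arith Cantor ClassicalEpsilon Ranalysis5.
From Coquelicot Require Import Coquelicot.
Open Scope R_scope.

(** Write f for F on the real line and call x, y linked when (x, y) is a limit of coincidences
    f x' = f y' with x' <> x. If distinct points were never linked, the self-intersections would
    form a discrete, hence countable, set.

    Locally, a linked pair (a, b) lies on a whole branch of coincidences. If f(a+x) - f(a) and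
    f(b+y) - f(b) vanish to orders k and m, choose n k = p m with n, p not both even and substitute
    x = s^n, y = rho s^p (1 + X). The equation f(a+x) = f(b+y) then determines X as a convergent
    power series in s, by a contraction in the Banach algebra of power series with absolutely
    summable coefficients on a small disk. X is real at infinitely many s tending to 0, hence on a
    real interval, and local injectivity forces n to be odd, so x covers a neighbourhood of 0.

    Consequently being linked is a closed equivalence relation that propagates to nearby points.
    Take a linked pair a < b of minimal length inside an initial one. Minimality makes its branch
    increasing, so the points linked to a point of [a, b] form an open and closed set, i.e. the
    whole line, and the image of f is the image of [a, b], where f(a) = f(b). *)

(** * Partial sums and convergent series *)

(** When [k] and [m] both exceed 1, the intersection equation is singular at 0 and its solutions
    involve fractional powers; the exponents [n] and [p] clear them. Dividing by [s^(n k) = s^(p m)]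
    leaves [(1+X)^m v(P(1+X)) = U] with [P] near 0 and [U] near 1, whose derivative in [X] at 0 is
    close to [m], hence invertible.

    The contraction is needed in two norms: among power series, to make [X] analytic, and at a
    single [s], to recognise a given real coincidence as the value [X s]. The estimates are
    therefore proved once for an abstract normed class, with constants fixed before the class.

    The scale is real because the ratio of the leading coefficients is a limit of positive numbers
    [Y^m]. If [n] were even, [p] would be odd, and [s], [-s] would give the same [x] but nonzero [y]
    of opposite signs with equal images.

    Limits of coincidences are used instead of coincidences because an isolated crossing does not
    propagate to nearby points. *)

Fixpoint csum (u : nat -> C) (n : nat) : C :=
  match n with O => RtoC 0 | S k => Cplus (csum u k) (u k) end.

Fixpoint rsum (u : nat -> R) (n : nat) : R :=
  match n with O => 0 | S k => rsum u k + u k end.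

Definition sums_to (u : nat -> C) (l : C) : Prop :=
  forall eps, 0 < eps -> exists N, forall n, (N <= n)%nat ->
    Cmod (Cminus (csum u n) l) < eps.

Lemma Cmod_minus_sym (x y : C) : Cmod (Cminus x y) = Cmod (Cminus y x).
Proof. rewrite <- Cmod_opp. f_equal. ring. Qed.

Lemma Cmod_minus_triangle (x y z : C) :
  Cmod (Cminus x z) <= Cmod (Cminus x y) + Cmod (Cminus y z).
Proof.
  replace (Cminus x z) with (Cplus (Cminus x y) (Cminus y z)) by ring.
  apply Cmod_triangle.
Qed.

Lemma Cmod_minus_le (x y : C) : Cmod (Cminus x y) <= Cmod x + Cmod y.
Proof. unfold Cminus. rewrite <- (Cmod_opp y). apply Cmod_triangle. Qed.

Lemma Cmod_le_plus (x y : C) : Cmod x <= Cmod y + Cmod (Cminus x y).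
Proof. replace x with (Cplus y (Cminus x y)) at 1 by ring. apply Cmod_triangle. Qed.

Lemma Cminus_eq_0 (x y : C) : Cminus x y = RtoC 0 -> x = y.
Proof. intros H. replace x with (Cplus (Cminus x y) y) by ring. rewrite H. ring. Qed.

Lemma Cmod_small_eq (x y : C) :
  (forall eps, 0 < eps -> Cmod (Cminus x y) <= eps) -> x = y.
Proof.
  intros H. apply Cminus_eq_0, Cmod_eq_0.
  destruct (Rle_lt_or_eq_dec 0 _ (Cmod_ge_0 (Cminus x y))) as [h | h]; [|auto].
  specialize (H (Cmod (Cminus x y) / 2)). lra.
Qed.

Lemma csum_ext u v n : (forall i, (i < n)%nat -> u i = v i) -> csum u n = csum v n.
Proof.
  induction n as [|n IH]; intros H; simpl; [auto|].
  rewrite IH by (intros; apply H; lia). now rewrite H by lia.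
Qed.

Lemma rsum_ext u v n : (forall i, (i < n)%nat -> u i = v i) -> rsum u n = rsum v n.
Proof.
  induction n as [|n IH]; intros H; simpl; [auto|].
  rewrite IH by (intros; apply H; lia). now rewrite H by lia.
Qed.

Lemma csum_plus u v n :
  csum (fun i => Cplus (u i) (v i)) n = Cplus (csum u n) (csum v n).
Proof. induction n as [|n IH]; simpl; [ring | rewrite IH; ring]. Qed.

Lemma csum_minus u v n :
  csum (fun i => Cminus (u i) (v i)) n = Cminus (csum u n) (csum v n).
Proof. induction n as [|n IH]; simpl; [ring | rewrite IH; ring]. Qed.

Lemma csum_scal c u n : csum (fun i => Cmult c (u i)) n = Cmult c (csum u n).
Proof. induction n as [|n IH]; simpl; [ring | rewrite IH; ring]. Qed.

Lemma rsum_scal c u n : rsum (fun i => c * u i) n = c * rsum u n.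
Proof. induction n as [|n IH]; simpl; [ring | rewrite IH; ring]. Qed.

Lemma rsum_plus u v n : rsum (fun i => u i + v i) n = rsum u n + rsum v n.
Proof. induction n as [|n IH]; simpl; [ring | rewrite IH; ring]. Qed.

Lemma csum_conj u n : csum (fun i => Cconj (u i)) n = Cconj (csum u n).
Proof.
  induction n as [|n IH]; simpl.
  - unfold Cconj, RtoC; simpl. f_equal. ring.
  - rewrite IH. unfold Cconj, Cplus; simpl. f_equal. ring.
Qed.

Lemma csum_swap (u : nat -> nat -> C) m n :
  csum (fun i => csum (u i) n) m = csum (fun j => csum (fun i => u i j) m) n.
Proof.
  induction m as [|m IH]; simpl.
  - induction n as [|n IHn]; simpl; [auto | rewrite <- IHn; ring].
  - now rewrite IH, csum_plus.
Qed.

Lemma rsum_swap (u : nat -> nat -> R) m n :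
  rsum (fun i => rsum (u i) n) m = rsum (fun j => rsum (fun i => u i j) m) n.
Proof.
  induction m as [|m IH]; simpl.
  - induction n as [|n IHn]; simpl; [auto | rewrite <- IHn; ring].
  - now rewrite IH, rsum_plus.
Qed.

Lemma rsum_le_loc u v n :
  (forall i, (i < n)%nat -> u i <= v i) -> rsum u n <= rsum v n.
Proof.
  induction n as [|n IH]; intros H; simpl; [lra|].
  apply Rplus_le_compat; [apply IH; intros; apply H; lia | apply H; lia].
Qed.

Lemma rsum_le u v n : (forall i, u i <= v i) -> rsum u n <= rsum v n.
Proof. intros; now apply rsum_le_loc. Qed.

Lemma rsum_diff_le u v m n : (forall i, u i <= v i) -> (m <= n)%nat ->
  rsum u n - rsum u m <= rsum v n - rsum v m.
Proof. intros H. induction 1 as [|n _ IH]; simpl; [lra | specialize (H n); lra]. Qed.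

Lemma rsum_incr u m n : (forall i, 0 <= u i) -> (m <= n)%nat -> rsum u m <= rsum u n.
Proof. intros H. induction 1 as [|n _ IH]; simpl; [lra | specialize (H n); lra]. Qed.

Lemma rsum_term u n : (forall i, 0 <= u i) -> u n <= rsum u (S n).
Proof. intros H. simpl. pose proof (rsum_incr u 0 n H ltac:(lia)). simpl in *. lra. Qed.

Lemma rsum_geom n : rsum (fun i => (1/2) ^ i) n <= 2.
Proof.
  assert (H : rsum (fun i => (1/2) ^ i) n = 2 - 2 * (1/2) ^ n)
    by (induction n as [|n IH]; simpl; [ring | rewrite IH; field]).
  rewrite H. assert (0 < (1/2) ^ n) by (apply pow_lt; lra). lra.
Qed.

Lemma Cmod_csum_diff_le u m n : (m <= n)%nat ->
  Cmod (Cminus (csum u n) (csum u m)) <=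
  rsum (fun i => Cmod (u i)) n - rsum (fun i => Cmod (u i)) m.
Proof.
  induction 1 as [|n _ IH]; simpl.
  - replace (Cminus (csum u m) (csum u m)) with (RtoC 0) by ring. rewrite Cmod_0. lra.
  - replace (Cminus (Cplus (csum u n) (u n)) (csum u m))
      with (Cplus (Cminus (csum u n) (csum u m)) (u n)) by ring.
    pose proof (Cmod_triangle (Cminus (csum u n) (csum u m)) (u n)). lra.
Qed.

Lemma Cmod_csum_le u n : Cmod (csum u n) <= rsum (fun i => Cmod (u i)) n.
Proof.
  pose proof (Cmod_csum_diff_le u 0 n ltac:(lia)) as H. simpl in H.
  replace (Cminus (csum u n) (RtoC 0)) with (csum u n) in H by ring. lra.
Qed.

Lemma sum_n_csum (u : nat -> C) n : sum_n (G := C_AbelianMonoid) u n = csum u (S n).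
Proof.
  induction n as [|n IH].
  - rewrite sum_O. simpl. ring.
  - rewrite sum_Sn, IH. reflexivity.
Qed.

Lemma sum_n_rsum (u : nat -> R) n : sum_n u n = rsum u (S n).
Proof.
  induction n as [|n IH].
  - rewrite sum_O. simpl. ring.
  - rewrite sum_Sn, IH. reflexivity.
Qed.

Lemma is_series_sums_to (u : nat -> C) (l : C) :
  is_series (V := C_NormedModule) u l -> sums_to u l.
Proof.
  intros H eps Heps.
  destruct (proj1 (filterlim_locally_ball_norm _ _) H (mkposreal eps Heps)) as [N HN].
  exists (S N). intros [|n] Hn; [lia|].
  specialize (HN n ltac:(lia)). rewrite sum_n_csum in HN. exact HN.
Qed.

Lemma sums_to_ext u v l : (forall i, u i = v i) -> sums_to u l -> sums_to v l.
Proof.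
  intros E H eps Heps. destruct (H eps Heps) as [N HN]. exists N.
  intros n Hn. rewrite <- (csum_ext u v) by auto. auto.
Qed.

Lemma sums_to_plus u v l k :
  sums_to u l -> sums_to v k -> sums_to (fun i => Cplus (u i) (v i)) (Cplus l k).
Proof.
  intros Hu Hv eps Heps.
  destruct (Hu (eps/2) ltac:(lra)) as [N1 H1]. destruct (Hv (eps/2) ltac:(lra)) as [N2 H2].
  exists (max N1 N2). intros n Hn. rewrite csum_plus.
  replace (Cminus (Cplus (csum u n) (csum v n)) (Cplus l k))
    with (Cplus (Cminus (csum u n) l) (Cminus (csum v n) k)) by ring.
  eapply Rle_lt_trans; [apply Cmod_triangle|].
  specialize (H1 n ltac:(lia)). specialize (H2 n ltac:(lia)). lra.
Qed.

Lemma sums_to_scal c u l : sums_to u l -> sums_to (fun i => Cmult c (u i)) (Cmult c l).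
Proof.
  intros Hu eps Heps. pose proof (Cmod_ge_0 c) as Hc.
  destruct (Hu (eps / (Cmod c + 1))) as [N H]; [apply Rdiv_lt_0_compat; lra|].
  exists N. intros n Hn. rewrite csum_scal.
  replace (Cminus (Cmult c (csum u n)) (Cmult c l))
    with (Cmult c (Cminus (csum u n) l)) by ring.
  rewrite Cmod_mult. specialize (H n Hn).
  apply Rle_lt_trans with (Cmod c * (eps / (Cmod c + 1))).
  - apply Rmult_le_compat_l; lra.
  - apply Rmult_lt_reg_r with (Cmod c + 1); [lra|]. field_simplify; [|lra]. nra.
Qed.

Lemma sums_to_conj u l : sums_to u l -> sums_to (fun i => Cconj (u i)) (Cconj l).
Proof.
  intros H eps Heps. destruct (H eps Heps) as [N HN]. exists N. intros n Hn.
  rewrite csum_conj.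
  replace (Cminus (Cconj (csum u n)) (Cconj l)) with (Cconj (Cminus (csum u n) l)).
  - rewrite Cmod_conj. auto.
  - unfold Cconj, Cminus, Cplus, Copp; simpl. f_equal; ring.
Qed.

(** Moves bounds from finite sums to the limit; norm bounds, remainder bounds and uniqueness of sums
    all come from it. *)
Lemma sums_to_close u l c L :
  sums_to u l -> (exists N, forall n, (N <= n)%nat -> Cmod (Cminus (csum u n) c) <= L) ->
  Cmod (Cminus l c) <= L.
Proof.
  intros H [N1 H1]. apply Rnot_lt_le. intros Hlt.
  destruct (H (Cmod (Cminus l c) - L) ltac:(lra)) as [N2 H2].
  specialize (H1 (max N1 N2) ltac:(lia)). specialize (H2 (max N1 N2) ltac:(lia)).
  pose proof (Cmod_minus_triangle l (csum u (max N1 N2)) c).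
  rewrite Cmod_minus_sym in H2. lra.
Qed.

Lemma Cmod_sums_to_le u l L :
  sums_to u l -> (forall n, rsum (fun i => Cmod (u i)) n <= L) -> Cmod l <= L.
Proof.
  intros H HL. replace l with (Cminus l (RtoC 0)) by ring.
  apply (sums_to_close u); auto. exists O. intros n _.
  replace (Cminus (csum u n) (RtoC 0)) with (csum u n) by ring.
  eapply Rle_trans; [apply Cmod_csum_le | auto].
Qed.

Lemma sums_to_unique u l k : sums_to u l -> sums_to u k -> l = k.
Proof.
  intros Hl Hk. apply Cmod_small_eq. intros eps Heps.
  apply (sums_to_close u); auto. destruct (Hk eps Heps) as [N HN].
  exists N. intros n Hn. left. auto.
Qed.

Lemma sums_to_remainder u l b L n :
  sums_to u l -> (forall i, Cmod (u i) <= b i) -> (forall n, rsum b n <= L) ->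
  Cmod (Cminus l (csum u n)) <= L - rsum b n.
Proof.
  intros H Hb HL. apply (sums_to_close u); auto. exists n. intros m Hm.
  eapply Rle_trans; [now apply Cmod_csum_diff_le|].
  eapply Rle_trans; [apply rsum_diff_le; eauto|]. specialize (HL m). lra.
Qed.

Lemma bounded_rsum_Cauchy b L :
  (forall i, 0 <= b i) -> (forall n, rsum b n <= L) ->
  forall eps, 0 < eps -> exists N, forall n, (N <= n)%nat -> rsum b n - rsum b N < eps.
Proof.
  intros Hb HL eps Heps.
  destruct (ex_finite_lim_seq_incr (rsum b) L) as [l Hl].
  - intros n. simpl. specialize (Hb n). lra.
  - exact HL.
  - apply is_lim_seq_spec in Hl.
    destruct (Hl (mkposreal (eps/2) ltac:(lra))) as [N HN]. simpl in HN.
    exists N. intros n Hn. pose proof (HN n Hn) as H1. pose proof (HN N ltac:(lia)) as H2.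
    apply Rabs_def2 in H1. apply Rabs_def2 in H2. lra.
Qed.

Lemma dominated_sums_to (u : nat -> C) b L :
  (forall i, Cmod (u i) <= b i) -> (forall n, rsum b n <= L) -> exists l, sums_to u l.
Proof.
  intros Hb HL.
  assert (Hp : forall i, 0 <= b i)
    by (intros i; eapply Rle_trans; [apply Cmod_ge_0 | apply Hb]).
  destruct (ex_series_le (V := C_CompleteNormedModule) u b) as [l Hl].
  - intros n. apply Hb.
  - destruct (ex_finite_lim_seq_incr (sum_n b) L) as [l Hl].
    + intros n. rewrite !sum_n_rsum. simpl. specialize (Hp (S n)). lra.
    + intros n. rewrite sum_n_rsum. apply HL.
    + exists l. exact Hl.
  - exists l. now apply is_series_sums_to.
Qed.

Lemma sums_to_telescope (x : nat -> C) l :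
  sums_to (fun j => Cminus (x (S j)) (x j)) l ->
  forall eps, 0 < eps -> exists N, forall n, (N <= n)%nat ->
    Cmod (Cminus (x n) (Cplus (x O) l)) < eps.
Proof.
  intros H eps Heps. destruct (H eps Heps) as [N HN]. exists N. intros n Hn.
  specialize (HN n Hn).
  assert (E : forall n, csum (fun j => Cminus (x (S j)) (x j)) n = Cminus (x n) (x O)).
  { clear. induction n as [|n IH]; simpl; [ring | rewrite IH; ring]. }
  rewrite E in HN. replace (Cminus (x n) (Cplus (x O) l))
    with (Cminus (Cminus (x n) (x O)) l) by ring. exact HN.
Qed.

(** * Normed algebras of functions, and the algebra of convergent power series *)

(* [N f M] reads "f has norm at most M". *)
Record normed_class (D : R -> Prop) (N : (R -> C) -> R -> Prop) : Prop := {
  nc_sup : forall f M s, N f M -> D s -> Cmod (f s) <= M;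
  nc_ge0 : forall f M, N f M -> 0 <= M;
  nc_ext : forall f g A B, (forall s, D s -> f s = g s) -> A <= B -> N f A -> N g B;
  nc_const : forall c, N (fun _ => c) (Cmod c);
  nc_plus : forall f g A B, N f A -> N g B -> N (fun s => Cplus (f s) (g s)) (A + B);
  nc_mult : forall f g A B, N f A -> N g B -> N (fun s => Cmult (f s) (g s)) (A * B);
  nc_series : forall (f : nat -> R -> C) (M : nat -> R) g L,
    (forall j, N (f j) (M j)) -> (forall n, rsum M n <= L) ->
    (forall s, D s -> sums_to (fun j => f j s) (g s)) -> N g L }.

(** A weighted l1 norm of the coefficients: submultiplicative, and dominating the supremum on the
    disk. Values are prescribed at real [s] only, where conjugating the coefficients conjugates the
    function; the reality of [X] rests on this. *)
Definition ps_norm (r : R) (f : R -> C) (M : R) : Prop :=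
  exists a : nat -> C, (forall n, rsum (fun i => Cmod (a i) * r ^ i) n <= M) /\
    forall s, Rabs s <= r -> sums_to (fun i => Cmult (a i) (Cpow (RtoC s) i)) (f s).

Lemma ps_term_le (r s : R) (c : C) i :
  Rabs s <= r -> Cmod (Cmult c (Cpow (RtoC s) i)) <= Cmod c * r ^ i.
Proof.
  intros Hs. rewrite Cmod_mult, Cmod_pow, Cmod_R.
  apply Rmult_le_compat_l; [apply Cmod_ge_0|].
  apply pow_incr. split; [apply Rabs_pos | auto].
Qed.

Lemma columns_converge (a : nat -> nat -> C) (c : nat -> C) (w : nat -> R) n :
  (forall i, 0 <= w i) -> (forall i, sums_to (fun j => a j i) (c i)) ->
  forall eps, 0 < eps -> exists J0, forall J, (J0 <= J)%nat ->
    rsum (fun i => Cmod (Cminus (c i) (csum (fun j => a j i) J)) * w i) n < eps.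
Proof.
  intros Hw Hc. induction n as [|n IH]; intros eps Heps; simpl.
  - exists O. intros; lra.
  - destruct (IH (eps/2) ltac:(lra)) as [J1 H1].
    destruct (Hc n (eps / 2 / (w n + 1))) as [J2 H2].
    { specialize (Hw n). apply Rdiv_lt_0_compat; lra. }
    exists (max J1 J2). intros J HJ. specialize (H1 J ltac:(lia)).
    specialize (H2 J ltac:(lia)). rewrite Cmod_minus_sym in H2.
    specialize (Hw n).
    enough (Cmod (Cminus (c n) (csum (fun j => a j n) J)) * w n <= eps / 2) by lra.
    apply Rle_trans with (eps / 2 / (w n + 1) * w n).
    + apply Rmult_le_compat_r; lra.
    + apply Rmult_le_reg_r with (w n + 1); [lra|]. field_simplify; [|lra]. nra.
Qed.

Lemma rows_converge (x : nat -> nat -> C) (l : nat -> C) J :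
  (forall j, sums_to (x j) (l j)) ->
  forall eps, 0 < eps -> exists N, forall n, (N <= n)%nat ->
    rsum (fun j => Cmod (Cminus (l j) (csum (x j) n))) J < eps.
Proof.
  intros H. induction J as [|J IH]; intros eps Heps; simpl.
  - exists O. intros; lra.
  - destruct (IH (eps/2) ltac:(lra)) as [N1 H1]. destruct (H J (eps/2) ltac:(lra)) as [N2 H2].
    exists (max N1 N2). intros n Hn. specialize (H1 n ltac:(lia)). specialize (H2 n ltac:(lia)).
    rewrite Cmod_minus_sym in H2. lra.
Qed.

(** Completeness of the algebra, by interchange in a double series: the coefficients of [g] are the
    column sums [c i] of the [a j i], which converge because [Cmod (a j i) * r ^ i <= M j]. *)
Lemma ps_norm_series r (f : nat -> R -> C) (M : nat -> R) g L : 0 < r ->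
  (forall j, ps_norm r (f j) (M j)) -> (forall n, rsum M n <= L) ->
  (forall s, Rabs s <= r -> sums_to (fun j => f j s) (g s)) -> ps_norm r g L.
Proof.
  intros Hr Hf HL Hg.
  apply choice in Hf as [a Ha].
  assert (Hri : forall i, 0 < r ^ i) by (intros; now apply pow_lt).
  assert (Hpos : forall j i, 0 <= Cmod (a j i) * r ^ i).
  { intros j i. apply Rmult_le_pos; [apply Cmod_ge_0 | left; auto]. }
  assert (Hterm : forall j i, Cmod (a j i) * r ^ i <= M j).
  { intros j i. eapply Rle_trans; [|apply (proj1 (Ha j) (S i))].
    apply (rsum_term (fun i => Cmod (a j i) * r ^ i)). auto. }
  assert (HM : forall j, 0 <= M j) by (intros j; eapply Rle_trans; [apply (Hpos j O) | auto]).
  assert (Hc : forall i, exists c, sums_to (fun j => a j i) c).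
  { intros i. apply (dominated_sums_to _ (fun j => / r ^ i * M j) (/ r ^ i * L)).
    - intros j. apply Rmult_le_reg_r with (r ^ i); auto.
      replace (/ r ^ i * M j * r ^ i) with (M j) by (field; specialize (Hri i); lra). auto.
    - intros n. rewrite rsum_scal. apply Rmult_le_compat_l; auto.
      left; now apply Rinv_0_lt_compat. }
  apply choice in Hc as [c Hc]. exists c. split.
  (* The finitely many [c i] are replaced by column sums up to [J]; after swapping the two finite
     sums, what remains is at most [rsum M J <= L]. *)
  - intros n. apply le_epsilon. intros eps Heps.
    destruct (columns_converge a c (fun i => r ^ i) n (fun i => Rlt_le _ _ (Hri i)) Hc eps Heps)
      as [J HJ].
    specialize (HJ J ltac:(lia)).
    assert (E1 : rsum (fun i => Cmod (c i) * r ^ i) n <=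
      rsum (fun i => Cmod (Cminus (c i) (csum (fun j => a j i) J)) * r ^ i
                     + rsum (fun j => Cmod (a j i) * r ^ i) J) n).
    { apply rsum_le. intros i.
      rewrite (rsum_ext _ (fun j => r ^ i * Cmod (a j i))) by (intros; ring).
      rewrite rsum_scal.
      pose proof (Cmod_le_plus (c i) (csum (fun j => a j i) J)).
      pose proof (Cmod_csum_le (fun j => a j i) J). specialize (Hri i). nra. }
    rewrite rsum_plus, (rsum_swap (fun i j => Cmod (a j i) * r ^ i)) in E1.
    assert (E2 : rsum (fun j => rsum (fun i => Cmod (a j i) * r ^ i) n) J <= rsum M J)
      by (apply rsum_le; intros j; apply Ha).
    specialize (HL J). lra.
  - intros s Hs eps Heps.
    (* The order of choices matters: [J0] makes the later rows negligible, [N] serves to truncate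
       the first [J0] rows, and [J] is chosen after [n]. The errors are [eps/6] for the columns,
       [2 * eps / 3] for the rows and [eps/6] for [g s]. *)
    destruct (bounded_rsum_Cauchy M L HM HL (eps/3) ltac:(lra)) as [J0 HJ0].
    destruct (rows_converge (fun j i => Cmult (a j i) (Cpow (RtoC s) i))
                (fun j => f j s) J0 (fun j => proj2 (Ha j) s Hs) (eps/3) ltac:(lra)) as [N HN].
    exists N. intros n Hn. specialize (HN n Hn).
    destruct (columns_converge a c (fun i => r ^ i) n (fun i => Rlt_le _ _ (Hri i)) Hc
                (eps/6) ltac:(lra)) as [J1 HJ1].
    destruct (Hg s Hs (eps/6) ltac:(lra)) as [J2 HJ2].
    set (J := max J0 (max J1 J2)).
    specialize (HJ0 J ltac:(lia)). specialize (HJ1 J ltac:(lia)). specialize (HJ2 J ltac:(lia)).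
    set (p := fun j => csum (fun i => Cmult (a j i) (Cpow (RtoC s) i)) n).
    assert (E1 : Cmod (Cminus (csum (fun i => Cmult (c i) (Cpow (RtoC s) i)) n) (csum p J))
                 <= eps/6).
    { unfold p. rewrite (csum_swap (fun j i => Cmult (a j i) (Cpow (RtoC s) i))).
      rewrite <- csum_minus.
      eapply Rle_trans; [apply Cmod_csum_le|]. eapply Rle_trans; [|left; apply HJ1].
      apply rsum_le. intros i.
      replace (Cminus _ _) with
        (Cmult (Cminus (c i) (csum (fun j => a j i) J)) (Cpow (RtoC s) i)).
      - now apply ps_term_le.
      - rewrite (csum_ext (fun j => Cmult (a j i) (Cpow (RtoC s) i))
          (fun j => Cmult (Cpow (RtoC s) i) (a j i))) by (intros; ring).
        rewrite csum_scal. ring. }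
    assert (E2 : Cmod (Cminus (csum (fun j => f j s) J) (csum p J)) <= 2 * eps / 3).
    { rewrite <- csum_minus. eapply Rle_trans; [apply Cmod_csum_le|].
      assert (H : forall j, Cmod (Cminus (f j s) (p j)) <= M j).
      { intros j. unfold p. eapply Rle_trans.
        - apply (sums_to_remainder _ _ (fun i => Cmod (a j i) * r ^ i) (M j)).
          + now apply Ha.
          + intros i. now apply ps_term_le.
          + apply Ha.
        - pose proof (rsum_incr (fun i => Cmod (a j i) * r ^ i) 0 n (Hpos j) ltac:(lia)) as G.
          simpl in G. lra. }
      pose proof (rsum_diff_le _ M J0 J H ltac:(lia)). unfold p in *. lra. }
    pose proof (Cmod_minus_triangle (csum (fun i => Cmult (c i) (Cpow (RtoC s) i)) n)
                  (csum p J) (g s)).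
    pose proof (Cmod_minus_triangle (csum p J) (csum (fun j => f j s) J) (g s)).
    rewrite Cmod_minus_sym in E2. lra.
Qed.

Lemma sums_to_shift (u : nat -> C) k l :
  sums_to u l -> sums_to (fun i => if le_lt_dec k i then u (i - k)%nat else RtoC 0) l.
Proof.
  intros H eps Heps. destruct (H eps Heps) as [N HN]. exists (N + k)%nat. intros n Hn.
  assert (E : csum (fun i => if le_lt_dec k i then u (i - k)%nat else RtoC 0) n
              = csum u (n - k)); [|rewrite E; apply HN; lia].
  clear. induction n as [|n IH]; [auto|]. simpl csum at 1. rewrite IH.
  destruct (le_lt_dec k n).
  - now replace (S n - k)%nat with (S (n - k)) by lia.
  - replace (S n - k)%nat with O by lia. replace (n - k)%nat with O by lia. simpl. ring.
Qed.

(** Multiplying by a monomial only shifts coefficients. A product [f g] is then the series of the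
    functions [a_j s^j g], so it is handled by completeness and no Cauchy product is needed. *)
Lemma ps_norm_monomial_mult r (c : C) k g B : 0 < r -> ps_norm r g B ->
  ps_norm r (fun s => Cmult (Cmult c (Cpow (RtoC s) k)) (g s)) (Cmod c * r ^ k * B).
Proof.
  intros Hr [b [Hb1 Hb2]].
  exists (fun i => if le_lt_dec k i then Cmult c (b (i - k)%nat) else RtoC 0). split.
  - intros n.
    assert (E : rsum (fun i => Cmod (if le_lt_dec k i then Cmult c (b (i - k)%nat) else RtoC 0)
                               * r ^ i) n
              = Cmod c * r ^ k * rsum (fun i => Cmod (b i) * r ^ i) (n - k)).
    { induction n as [|n IH]; [simpl; ring|]. simpl rsum at 1. rewrite IH.
      destruct (le_lt_dec k n).
      - replace (S n - k)%nat with (S (n - k)) by lia. simpl.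
        rewrite Cmod_mult.
        assert (E : r ^ n = r ^ k * r ^ (n - k)) by (rewrite <- pow_add; f_equal; lia).
        rewrite E. ring.
      - rewrite Cmod_0. replace (S n - k)%nat with O by lia.
        replace (n - k)%nat with O by lia. simpl. ring. }
    rewrite E. apply Rmult_le_compat_l; auto.
    apply Rmult_le_pos; [apply Cmod_ge_0 | left; now apply pow_lt].
  - intros s Hs.
    apply sums_to_ext with (fun i => if le_lt_dec k i
      then (fun i => Cmult (Cmult c (Cpow (RtoC s) k)) (Cmult (b i) (Cpow (RtoC s) i))) (i - k)%nat
      else RtoC 0).
    + intros i. destruct (le_lt_dec k i); [|ring].
      assert (E : Cpow (RtoC s) i = Cmult (Cpow (RtoC s) k) (Cpow (RtoC s) (i - k)))
        by (rewrite <- Cpow_add_r; f_equal; lia).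
      rewrite E. ring.
    + apply (sums_to_shift
        (fun i => Cmult (Cmult c (Cpow (RtoC s) k)) (Cmult (b i) (Cpow (RtoC s) i)))).
      apply sums_to_scal, Hb2, Hs.
Qed.

Lemma ps_norm_class r : 0 < r -> normed_class (fun s => Rabs s <= r) (ps_norm r).
Proof.
  intros Hr. split.
  - intros f M s [a [Ha1 Ha2]] Hs. apply (Cmod_sums_to_le _ _ _ (Ha2 s Hs)).
    intros n. eapply Rle_trans; [|apply (Ha1 n)]. apply rsum_le. intros i. now apply ps_term_le.
  - intros f M [a [Ha _]]. apply (Ha O).
  - intros f g A B E HAB [a [Ha1 Ha2]]. exists a. split.
    + intros n. eapply Rle_trans; [apply Ha1 | auto].
    + intros s Hs. rewrite <- E by auto. auto.
  - intros c. exists (fun i => match i with O => c | S _ => RtoC 0 end).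
    assert (E : forall n, rsum (fun i => Cmod (match i with O => c | S _ => RtoC 0 end) * r ^ i) (S n)
                = Cmod c).
    { induction n as [|n IH]; [simpl; ring|]. simpl in IH |- *. rewrite IH, Cmod_0. ring. }
    split.
    + intros [|n]; [apply Cmod_ge_0 | rewrite E; apply Rle_refl].
    + intros s Hs eps Heps. exists 1%nat. intros [|n] Hn; [lia|].
      replace (csum _ (S n)) with c.
      * replace (Cminus c c) with (RtoC 0) by ring. now rewrite Cmod_0.
      * clear. induction n as [|n IH]; simpl in *; [ring | rewrite <- IH; ring].
  - intros f g A B [a [Ha1 Ha2]] [b [Hb1 Hb2]].
    exists (fun i => Cplus (a i) (b i)). split.
    + intros n. apply Rle_trans with
        (rsum (fun i => Cmod (a i) * r ^ i + Cmod (b i) * r ^ i) n).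
      * apply rsum_le. intros i. rewrite <- Rmult_plus_distr_r.
        apply Rmult_le_compat_r; [left; now apply pow_lt | apply Cmod_triangle].
      * rewrite rsum_plus. apply Rplus_le_compat; auto.
    + intros s Hs. eapply sums_to_ext; [|apply sums_to_plus; [apply Ha2 | apply Hb2]; auto].
      intros i. simpl. ring.
  - intros f g A B [a [Ha1 Ha2]] Hg.
    assert (HB : 0 <= B) by (destruct Hg as [b [Hb _]]; apply (Hb O)).
    apply (ps_norm_series r
      (fun j s => Cmult (Cmult (a j) (Cpow (RtoC s) j)) (g s))
      (fun j => Cmod (a j) * r ^ j * B)); auto.
    + intros j. now apply ps_norm_monomial_mult.
    + intros n. rewrite (rsum_ext _ (fun j => B * (Cmod (a j) * r ^ j))) by (intros; ring).
      rewrite rsum_scal. specialize (Ha1 n). nra.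
    + intros s Hs. replace (Cmult (f s) (g s)) with (Cmult (g s) (f s)) by ring.
      eapply sums_to_ext; [|apply sums_to_scal, Ha2, Hs]. intros i. simpl. ring.
  - intros f M g L. now apply ps_norm_series.
Qed.

(** Evaluation at one point as a normed class: every estimate proved for a general class specialises
    to plain complex numbers. *)
Lemma point_norm_class s0 :
  normed_class (fun s => s = s0) (fun f M => Cmod (f s0) <= M).
Proof.
  split.
  - intros f M s H ->. auto.
  - intros f M H. eapply Rle_trans; [apply Cmod_ge_0 | apply H].
  - intros f g A B E HAB H. rewrite <- E by auto. lra.
  - intros c. lra.
  - intros f g A B Hf Hg. eapply Rle_trans; [apply Cmod_triangle | lra].
  - intros f g A B Hf Hg. rewrite Cmod_mult. apply Rmult_le_compat; auto using Cmod_ge_0.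
  - intros f M g L Hf HL Hg. apply (Cmod_sums_to_le _ _ _ (Hg s0 eq_refl)).
    intros n. eapply Rle_trans; [apply rsum_le, Hf | apply HL].
Qed.

(** * Estimates valid in every normed class *)

Section NormedClass.
Variables (D : R -> Prop) (N : (R -> C) -> R -> Prop).
Hypothesis HN : normed_class D N.

Lemma nc_scal c f A : N f A -> N (fun s => Cmult c (f s)) (Cmod c * A).
Proof. intros H. apply (nc_mult _ _ HN); auto. apply (nc_const _ _ HN). Qed.

Lemma nc_minus f g A B : N f A -> N g B -> N (fun s => Cminus (f s) (g s)) (A + B).
Proof.
  intros Hf Hg.
  apply (nc_ext _ _ HN (fun s => Cplus (f s) (Cmult (RtoC (- (1))) (g s))) _
           (A + Cmod (RtoC (- (1))) * B)).
  - intros s _. rewrite RtoC_opp. ring.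
  - rewrite Cmod_R, Rabs_left by lra. lra.
  - apply (nc_plus _ _ HN); auto. now apply nc_scal.
Qed.

Lemma nc_pow f A n : N f A -> N (fun s => Cpow (f s) n) (A ^ n).
Proof.
  intros Hf. induction n as [|n IH]; simpl.
  - pose proof (nc_const _ _ HN (RtoC 1)) as H. now rewrite Cmod_1 in H.
  - now apply (nc_mult _ _ HN).
Qed.

Lemma nc_one_plus X eta : eta <= 1 -> N X eta -> N (fun s => Cplus (RtoC 1) (X s)) 2.
Proof.
  intros He HX. apply (nc_ext _ _ HN (fun s => Cplus (RtoC 1) (X s)) _ (Cmod (RtoC 1) + eta)); auto.
  - rewrite Cmod_1. lra.
  - apply (nc_plus _ _ HN); auto. apply (nc_const _ _ HN).
Qed.

(** The constant is [n R0^(n-1) del], written without a natural-number subtraction in the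
    exponent. *)
Lemma nc_pow_lip V W R0 del n : N V R0 -> N W R0 -> N (fun s => Cminus (V s) (W s)) del -> 0 < R0 ->
  N (fun s => Cminus (Cpow (V s) n) (Cpow (W s) n)) (del * / R0 * INR n * R0 ^ n).
Proof.
  intros HV HW Hd HR. induction n as [|n IH].
  - apply (nc_ext _ _ HN (fun _ => RtoC 0) _ (Cmod (RtoC 0))).
    + intros s _. simpl. ring.
    + rewrite Cmod_0. simpl. lra.
    + apply (nc_const _ _ HN).
  - apply (nc_ext _ _ HN (fun s => Cplus (Cmult (V s) (Cminus (Cpow (V s) n) (Cpow (W s) n)))
        (Cmult (Cminus (V s) (W s)) (Cpow (W s) n))) _
        (R0 * (del * / R0 * INR n * R0 ^ n) + del * R0 ^ n)).
    + intros s _. simpl. ring.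
    + rewrite S_INR. simpl. right. field. lra.
    + apply (nc_plus _ _ HN); apply (nc_mult _ _ HN); auto. now apply nc_pow.
Qed.
End NormedClass.

(** The gap between the radius [4 * rho] of the coefficient bound and the radius [rho] of use pays
    for Lipschitz estimates: of the gain [4^-n], one factor [2^-n] absorbs the [n] that comes from
    differences of [n]-th powers, and the other is summable with sum at most 2, whence the constant
    [2 * K / rho]. *)
Definition ps_sum (v : C -> C) (a : nat -> C) (K rho : R) : Prop :=
  0 < rho /\ (forall n, Cmod (a n) * (4 * rho) ^ n <= K) /\
  forall y, Cmod y <= rho -> sums_to (fun n => Cmult (a n) (Cpow y n)) (v y).

Lemma INR_le_pow2 n : INR n <= 2 ^ n.
Proof.
  induction n as [|n IH]; [simpl; lra|]. rewrite S_INR. simpl.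
  assert (1 <= 2 ^ n) by (apply pow_R1_Rle; lra). lra.
Qed.

Lemma ps_sum_K_ge0 v a K rho : ps_sum v a K rho -> 0 <= K.
Proof.
  intros [_ [H _]]. specialize (H O). simpl in H. pose proof (Cmod_ge_0 (a O)). lra.
Qed.

(** A mean value inequality obtained term by term, so that it holds in any normed class. With [W]
    constantly 0 it measures how far [v] is from its value at 0. *)
Lemma nc_comp_lip D N (HN : normed_class D N) v a K rho V W del :
  ps_sum v a K rho -> N V rho -> N W rho -> N (fun s => Cminus (V s) (W s)) del ->
  N (fun s => Cminus (v (V s)) (v (W s))) (2 * K / rho * del).
Proof.
  intros Hps HV HW Hd. pose proof (ps_sum_K_ge0 _ _ _ _ Hps) as HK.
  destruct Hps as [Hrho [Ha Hs]].
  assert (Hdel : 0 <= del) by (apply (nc_ge0 _ _ HN _ _ Hd)).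
  assert (Hir : 0 < / rho) by now apply Rinv_0_lt_compat.
  apply (nc_series _ _ HN
    (fun n s => Cmult (a n) (Cminus (Cpow (V s) n) (Cpow (W s) n)))
    (fun n => K * / rho * del * (1/2) ^ n)).
  - intros n. eapply (nc_ext _ _ HN _ _ (Cmod (a n) * (del * / rho * INR n * rho ^ n))).
    + intros s _. reflexivity.
    + specialize (Ha n). rewrite Rpow_mult_distr in Ha.
      assert (H4 : (4:R) ^ n = 2 ^ n * 2 ^ n) by (rewrite <- Rpow_mult_distr; f_equal; lra).
      assert (H2 : 0 < (2:R) ^ n) by (apply pow_lt; lra).
      assert (Hh : (1/2) ^ n = / 2 ^ n) by (rewrite <- pow_inv; f_equal; lra).
      rewrite Hh. pose proof (INR_le_pow2 n).
      apply Rmult_le_reg_r with (2 ^ n); auto.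
      replace (K * / rho * del * / 2 ^ n * 2 ^ n) with (K * (/ rho * del))
        by (field; split; lra).
      apply Rle_trans with (Cmod (a n) * (2 ^ n * 2 ^ n * rho ^ n) * (/ rho * del)).
      * replace (Cmod (a n) * (del * / rho * INR n * rho ^ n) * 2 ^ n)
          with ((Cmod (a n) * rho ^ n * 2 ^ n * (/ rho * del)) * INR n) by ring.
        replace (Cmod (a n) * (2 ^ n * 2 ^ n * rho ^ n) * (/ rho * del))
          with ((Cmod (a n) * rho ^ n * 2 ^ n * (/ rho * del)) * 2 ^ n) by ring.
        apply Rmult_le_compat_l; auto.
        pose proof (Cmod_ge_0 (a n)). assert (0 < rho ^ n) by now apply pow_lt.
        repeat apply Rmult_le_pos; lra.
      * rewrite H4 in Ha. apply Rmult_le_compat_r; auto. apply Rmult_le_pos; lra.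
    + apply (nc_scal _ _ HN). now apply (nc_pow_lip _ _ HN).
  - intros n. rewrite rsum_scal. pose proof (rsum_geom n).
    assert (0 <= K * / rho * del) by (repeat apply Rmult_le_pos; lra).
    replace (2 * K / rho * del) with (K * / rho * del * 2) by (unfold Rdiv; ring).
    now apply Rmult_le_compat_l.
  - intros s Ds.
    apply sums_to_ext with (fun n => Cplus (Cmult (a n) (Cpow (V s) n))
      (Cmult (RtoC (- (1))) (Cmult (a n) (Cpow (W s) n)))).
    { intros n. rewrite RtoC_opp. ring. }
    replace (Cminus (v (V s)) (v (W s))) with (Cplus (v (V s)) (Cmult (RtoC (- (1))) (v (W s))))
      by (rewrite RtoC_opp; ring).
    apply sums_to_plus; [|apply sums_to_scal]; apply Hs;
      eapply (nc_sup _ _ HN); eauto.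
Qed.

(** [A] depends on [m] alone: it is chosen before the class, so the same constant serves for power
    series and for single points. *)
Lemma nc_one_plus_pow_lip m : exists A, 0 <= A /\
  forall D N, normed_class D N -> forall X Y eta del, eta <= 1 ->
  N X eta -> N Y eta -> N (fun s => Cminus (X s) (Y s)) del ->
  N (fun s => Cminus (Cpow (Cplus (RtoC 1) (X s)) m) (Cpow (Cplus (RtoC 1) (Y s)) m)) (A * del).
Proof.
  induction m as [|m [A [HA IH]]].
  - exists 0. split; [lra|]. intros D N HN X Y eta del He HX HY Hd.
    apply (nc_ext _ _ HN (fun _ => RtoC 0) _ (Cmod (RtoC 0))).
    + intros s _. simpl. ring.
    + rewrite Cmod_0. lra.
    + apply (nc_const _ _ HN).
  - exists (2 * A + 2 ^ m). assert (0 < 2 ^ m) by (apply pow_lt; lra).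
    split; [lra|]. intros D N HN X Y eta del He HX HY Hd.
    apply (nc_ext _ _ HN (fun s => Cplus
      (Cmult (Cplus (RtoC 1) (X s))
        (Cminus (Cpow (Cplus (RtoC 1) (X s)) m) (Cpow (Cplus (RtoC 1) (Y s)) m)))
      (Cmult (Cminus (X s) (Y s)) (Cpow (Cplus (RtoC 1) (Y s)) m))) _
      (2 * (A * del) + del * 2 ^ m)).
    + intros s _. simpl. ring.
    + right. ring.
    + apply (nc_plus _ _ HN); apply (nc_mult _ _ HN); auto.
      * now apply (nc_one_plus _ _ HN X eta).
      * now apply (IH D N HN X Y eta).
      * apply (nc_pow _ _ HN). now apply (nc_one_plus _ _ HN Y eta).
Qed.

Lemma nc_one_plus_pow_quad m : exists A, 0 <= A /\
  forall D N, normed_class D N -> forall X Y eta del, eta <= 1 ->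
  N X eta -> N Y eta -> N (fun s => Cminus (X s) (Y s)) del ->
  N (fun s => Cminus (Cminus (Cpow (Cplus (RtoC 1) (X s)) m) (Cpow (Cplus (RtoC 1) (Y s)) m))
                (Cmult (RtoC (INR m)) (Cminus (X s) (Y s)))) (A * eta * del).
Proof.
  induction m as [|m [A [HA IH]]].
  - exists 0. split; [lra|]. intros D N HN X Y eta del He HX HY Hd.
    apply (nc_ext _ _ HN (fun _ => RtoC 0) _ (Cmod (RtoC 0))).
    + intros s _. simpl. ring.
    + rewrite Cmod_0. lra.
    + apply (nc_const _ _ HN).
  - destruct (nc_one_plus_pow_lip m) as [B [HB HL]].
    exists (A + 2 * B). split; [lra|]. intros D N HN X Y eta del He HX HY Hd.
    apply (nc_ext _ _ HN (fun s => Cplus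
      (Cminus (Cminus (Cpow (Cplus (RtoC 1) (X s)) m) (Cpow (Cplus (RtoC 1) (Y s)) m))
                (Cmult (RtoC (INR m)) (Cminus (X s) (Y s))))
      (Cplus (Cmult (Cminus (X s) (Y s))
                (Cminus (Cpow (Cplus (RtoC 1) (X s)) m) (Cpow (Cplus (RtoC 1) (RtoC 0)) m)))
             (Cmult (Y s)
        (Cminus (Cpow (Cplus (RtoC 1) (X s)) m) (Cpow (Cplus (RtoC 1) (Y s)) m))))) _
      (A * eta * del + (del * (B * eta) + eta * (B * del)))).
    + intros s _. rewrite S_INR, RtoC_plus. simpl.
      replace (Cplus (RtoC 1) (RtoC 0)) with (RtoC 1) by ring. rewrite Cpow_1_l. ring.
    + right. ring.
    + apply (nc_plus _ _ HN); [now apply (IH D N HN)|].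
      apply (nc_plus _ _ HN); apply (nc_mult _ _ HN); auto.
      * apply (HL D N HN X (fun _ => RtoC 0) eta); auto.
        -- apply (nc_ext _ _ HN (fun _ => RtoC 0) _ (Cmod (RtoC 0))); auto.
           ++ rewrite Cmod_0. apply (nc_ge0 _ _ HN _ _ HX).
           ++ apply (nc_const _ _ HN).
        -- apply (nc_ext _ _ HN X _ eta); auto; [|lra]. intros; ring.
      * now apply (HL D N HN X Y eta).
Qed.

(* A fixed point x solves (1+x)^m v(P(1+x)) = U; this is Newton's map with the slope frozen at
   its value m at P = 0. *)
Definition newton_map (m : nat) (v : C -> C) (P U x : C) : C :=
  Cminus x (Cmult (RtoC (/ INR m))
    (Cminus (Cmult (Cpow (Cplus (RtoC 1) x) m) (v (Cmult P (Cplus (RtoC 1) x)))) U)).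

(** Halving distances on the ball of radius [eta] and sending 0 within [eta / 2] together keep that
    ball invariant. Again [eta] and [del] precede the class, so existence among power series and
    uniqueness at a point concern the same ball. *)
Lemma newton_map_contracts m v a K rho eta0 :
  (1 <= m)%nat -> ps_sum v a K rho -> v (RtoC 0) = RtoC 1 -> 0 < eta0 ->
  exists eta del, 0 < eta <= eta0 /\ eta <= 1/2 /\ 0 < del /\
  forall D N, normed_class D N -> forall P U,
    N P del -> N (fun s => Cminus (U s) (RtoC 1)) del ->
    (forall X Y d, N X eta -> N Y eta -> N (fun s => Cminus (X s) (Y s)) d ->
      N (fun s => Cminus (newton_map m v (P s) (U s) (X s)) (newton_map m v (P s) (U s) (Y s)))
        (d / 2)) /\
    N (fun s => newton_map m v (P s) (U s) (RtoC 0)) (eta / 2).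
Proof.
  intros Hm Hps Hv0 He0.
  destruct (nc_one_plus_pow_lip m) as [A1 [HA1 HL1]].
  destruct (nc_one_plus_pow_quad m) as [A2 [HA2 HL2]].
  pose proof (ps_sum_K_ge0 _ _ _ _ Hps) as HK.
  pose proof (proj1 Hps) as Hrho.
  remember (2 * K / rho) as A3 eqn:EA3.
  assert (HA3 : 0 <= A3).
  { rewrite EA3. apply Rmult_le_pos; [lra|]. left. now apply Rinv_0_lt_compat. }
  (* Ensures [A2 * eta <= 1/4]: the nonlinearity of [(1+x)^m] takes half of the contraction factor
     [1/2], and [del] will reserve the other half for the variation of [v]. *)
  set (eta := Rmin eta0 (Rmin (1/2) (/ (4 * A2 + 4)))).
  assert (Heta : 0 < eta).
  { unfold eta. repeat apply Rmin_glb_lt; try lra. apply Rinv_0_lt_compat. lra. }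
  assert (Heta2 : A2 * eta <= 1/4).
  { apply Rle_trans with (A2 * / (4 * A2 + 4)).
    - apply Rmult_le_compat_l; auto. unfold eta. eapply Rle_trans; apply Rmin_r.
    - apply Rmult_le_reg_r with (4 * A2 + 4); [lra|].
      rewrite Rmult_assoc, Rinv_l by lra. lra. }
  assert (Heta3 : eta <= 1/2).
  { unfold eta. eapply Rle_trans; [apply Rmin_r | apply Rmin_l]. }
  assert (H2m : 0 < 2 ^ m) by (apply pow_lt; lra).
  (* [Q * del] is the Lipschitz cost of [v] not being constantly 1: the first summand comes from
     [(A - B)(VX - 1)], the second from [B (VX - VY)]. *)
  set (Q := 2 * A1 * A3 + 2 ^ m * A3).
  assert (HQ : 0 <= Q).
  { unfold Q. apply Rplus_le_le_0_compat; repeat apply Rmult_le_pos; lra. }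
  (* Three demands: the argument [P (1 + X)], of norm at most [2 * del], stays within [rho];
     [Q * del <= 1/4]; and the image of 0 has norm at most [A3 * del + del <= eta / 2]. *)
  set (del := Rmin (rho / 2) (Rmin (/ (4 * Q + 4)) (eta / 2 / (A3 + 1)))).
  assert (Hdel : 0 < del).
  { unfold del. repeat apply Rmin_glb_lt; try lra.
    - apply Rinv_0_lt_compat. lra.
    - apply Rdiv_lt_0_compat; lra. }
  assert (Hdel1 : 2 * del <= rho).
  { pose proof (Rmin_l (rho / 2) (Rmin (/ (4 * Q + 4)) (eta / 2 / (A3 + 1)))). fold del in H. lra. }
  assert (Hdel2 : Q * del <= 1/4).
  { apply Rle_trans with (Q * / (4 * Q + 4)).
    - apply Rmult_le_compat_l; auto. unfold del. eapply Rle_trans; [apply Rmin_r | apply Rmin_l].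
    - apply Rmult_le_reg_r with (4 * Q + 4); [lra|].
      rewrite Rmult_assoc, Rinv_l by lra. lra. }
  assert (Hdel3 : A3 * del + del <= eta / 2).
  { apply Rle_trans with ((A3 + 1) * (eta / 2 / (A3 + 1))).
    - replace (A3 * del + del) with ((A3 + 1) * del) by ring.
      apply Rmult_le_compat_l; [lra|]. unfold del. eapply Rle_trans; apply Rmin_r.
    - right. field. lra. }
  assert (Him : 0 < / INR m <= 1).
  { assert (1 <= INR m) by (replace 1 with (INR 1) by reflexivity; now apply le_INR).
    split; [apply Rinv_0_lt_compat; lra|]. rewrite <- Rinv_1. apply Rinv_le_contravar; lra. }
  assert (Him' : Cmod (RtoC (/ INR m)) <= 1) by (rewrite Cmod_R, Rabs_right; lra).
  assert (Hinv : Cmult (RtoC (/ INR m)) (RtoC (INR m)) = RtoC 1).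
  { rewrite <- RtoC_mult. f_equal. apply Rinv_l. intros E. rewrite E in Him.
    rewrite Rinv_0 in Him. lra. }
  exists eta, del. split; [split; [auto|apply Rmin_l]|]. split; [auto|]. split; [auto|].
  intros D N HN P U HP HU.
  assert (Hcomp : forall X, N X eta ->
    N (fun s => Cmult (P s) (Cplus (RtoC 1) (X s))) (2 * del)).
  { intros X HX. apply (nc_ext _ _ HN (fun s => Cmult (P s) (Cplus (RtoC 1) (X s))) _ (del * 2));
      auto; [lra|].
    apply (nc_mult _ _ HN); auto. apply (nc_one_plus _ _ HN X eta); auto. lra. }
  assert (Hzero : N (fun _ => RtoC 0) 0).
  { pose proof (nc_const _ _ HN (RtoC 0)) as H. now rewrite Cmod_0 in H. }
  assert (Hweak : forall f A B, A <= B -> N f A -> N f B).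
  { intros f A B HAB. now apply (nc_ext _ _ HN f f A B). }
  assert (Hv1 : forall V d, d <= rho -> N V d -> N (fun s => Cminus (v (V s)) (RtoC 1)) (A3 * d)).
  { intros V d Hd HV.
    apply (nc_ext _ _ HN (fun s => Cminus (v (V s)) (v (RtoC 0))) _ (A3 * d)); [|lra|].
    - intros s _. now rewrite Hv0.
    - rewrite EA3. apply (nc_comp_lip D N HN v a K rho V (fun _ => RtoC 0)); auto.
      + eapply Hweak; eauto.
      + eapply Hweak; [|apply Hzero]. lra.
      + apply (nc_ext _ _ HN V _ d); auto; [|lra]. intros; ring. }
  split.
  - intros X Y d HX HY Hd.
    assert (Hd0 : 0 <= d) by apply (nc_ge0 _ _ HN _ _ Hd).
    pose (A := fun s => Cpow (Cplus (RtoC 1) (X s)) m).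
    pose (B := fun s => Cpow (Cplus (RtoC 1) (Y s)) m).
    pose (VX := fun s => v (Cmult (P s) (Cplus (RtoC 1) (X s)))).
    pose (VY := fun s => v (Cmult (P s) (Cplus (RtoC 1) (Y s)))).
    (* The slope [m] cancels the linear part [X - Y]. What is left is the quadratic error of the
       power plus the two terms measured by [Q]. *)
    apply (nc_ext _ _ HN (fun s => Cmult (RtoC (- / INR m))
      (Cplus (Cminus (Cminus (A s) (B s)) (Cmult (RtoC (INR m)) (Cminus (X s) (Y s))))
        (Cplus (Cmult (Cminus (A s) (B s)) (Cminus (VX s) (RtoC 1)))
               (Cmult (B s) (Cminus (VX s) (VY s)))))) _
      (Cmod (RtoC (- / INR m)) *
        (A2 * eta * d + (A1 * d * (A3 * (2 * del)) + 2 ^ m * (A3 * (del * d)))))).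
    + intros s _. unfold newton_map. fold (A s) (B s) (VX s) (VY s).
      rewrite RtoC_opp.
      transitivity (Cplus (Cmult (Cmult (RtoC (/ INR m)) (RtoC (INR m))) (Cminus (X s) (Y s)))
        (Cmult (RtoC (/ INR m)) (Cminus (Cmult (B s) (VY s)) (Cmult (A s) (VX s)))));
        [ring | rewrite Hinv; ring].
    + rewrite RtoC_opp, Cmod_opp.
      apply Rle_trans with (1 * (A2 * eta * d + (A1 * d * (A3 * (2 * del)) + 2 ^ m * (A3 * (del * d))))).
      * apply Rmult_le_compat_r; auto. repeat apply Rplus_le_le_0_compat; repeat apply Rmult_le_pos; lra.
      * replace (1 * _) with ((A2 * eta + Q * del) * d) by (unfold Q; ring). nra.
    + apply (nc_scal _ _ HN). apply (nc_plus _ _ HN); [|apply (nc_plus _ _ HN)].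
      * apply (HL2 D N HN X Y eta d); auto. lra.
      * apply (nc_mult _ _ HN).
        -- apply (HL1 D N HN X Y eta d); auto. lra.
        -- now apply (Hv1 (fun s => Cmult (P s) (Cplus (RtoC 1) (X s)))); auto.
      * apply (nc_mult _ _ HN).
        -- apply (nc_pow _ _ HN). apply (nc_one_plus _ _ HN Y eta); auto. lra.
        -- rewrite EA3. apply (nc_comp_lip D N HN v a K rho
             (fun s => Cmult (P s) (Cplus (RtoC 1) (X s)))
             (fun s => Cmult (P s) (Cplus (RtoC 1) (Y s)))); auto;
             try (eapply Hweak; [apply Hdel1 | now apply Hcomp]).
           apply (nc_ext _ _ HN (fun s => Cmult (P s) (Cminus (X s) (Y s))) _ (del * d)).
           ++ intros; ring.
           ++ lra.
           ++ now apply (nc_mult _ _ HN).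
  - apply (nc_ext _ _ HN (fun s => Cmult (RtoC (- / INR m))
      (Cminus (Cminus (v (P s)) (RtoC 1)) (Cminus (U s) (RtoC 1)))) _
      (Cmod (RtoC (- / INR m)) * (A3 * del + del))).
    + intros s _. unfold newton_map. rewrite RtoC_opp.
      replace (Cplus (RtoC 1) (RtoC 0)) with (RtoC 1) by ring.
      rewrite Cpow_1_l. replace (Cmult (P s) (RtoC 1)) with (P s) by ring. ring.
    + rewrite RtoC_opp, Cmod_opp. apply Rle_trans with (1 * (A3 * del + del)); [|lra].
      apply Rmult_le_compat_r; auto. apply Rplus_le_le_0_compat; [apply Rmult_le_pos|]; lra.
    + apply (nc_scal _ _ HN), (nc_minus _ _ HN); auto. apply Hv1; auto. lra.
Qed.

(** * Implicit power series and branches of intersections *)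

(** Contraction in [ps_norm] makes the iterates from 0 converge to a power series; pointwise
    contraction shows that its value at each [s] is fixed, and is the only fixed point in the disk.
    Since uniqueness concerns a bare number [x], a solution known at a single [s] is identified with
    [X s]. *)
Lemma contraction_fixed_point (T : R -> C -> C) r eta : 0 < r -> 0 < eta ->
  (forall s, Rabs s <= r -> forall x y, Cmod x <= eta -> Cmod y <= eta ->
     Cmod (Cminus (T s x) (T s y)) <= Cmod (Cminus x y) / 2) ->
  (forall X Y d, ps_norm r X eta -> ps_norm r Y eta ->
     ps_norm r (fun s => Cminus (X s) (Y s)) d ->
     ps_norm r (fun s => Cminus (T s (X s)) (T s (Y s))) (d / 2)) ->
  ps_norm r (fun s => T s (RtoC 0)) (eta / 2) ->
  exists X, ps_norm r X eta /\ forall s, Rabs s <= r ->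
    T s (X s) = X s /\ forall x, Cmod x <= eta -> T s x = x -> x = X s.
Proof.
  intros Hr He Hpt Hlip H0.
  pose proof (ps_norm_class r Hr) as HN.
  pose (Xn := fun n s => Nat.iter n (T s) (RtoC 0)).
  assert (Hinv : forall n, ps_norm r (Xn n) eta /\
    ps_norm r (fun s => Cminus (Xn (S n) s) (Xn n s)) (eta / 2 * (1/2) ^ n)).
  { induction n as [|n [IH1 IH2]].
    - split.
      + apply (nc_ext _ _ HN (fun _ => RtoC 0) _ (Cmod (RtoC 0))); auto.
        * rewrite Cmod_0. lra.
        * apply (nc_const _ _ HN).
      + apply (nc_ext _ _ HN (fun s => T s (RtoC 0)) _ (eta / 2)); auto.
        * intros s _. simpl. ring.
        * simpl. lra.
    - assert (A : ps_norm r (Xn (S n)) eta).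
      (* Writing [T x] as [T 0 + (T x - T 0)] bounds it by [eta / 2 + eta / 2]. *)
      { apply (nc_ext _ _ HN
          (fun s => Cplus (T s (RtoC 0)) (Cminus (T s (Xn n s)) (T s (RtoC 0)))) _
          (eta / 2 + eta / 2)).
        - intros s _. unfold Xn. simpl. ring.
        - lra.
        - apply (nc_plus _ _ HN); auto.
          apply (Hlip (Xn n) (fun _ => RtoC 0)); auto.
          + apply (nc_ext _ _ HN (fun _ => RtoC 0) _ (Cmod (RtoC 0))); auto.
            * rewrite Cmod_0. lra.
            * apply (nc_const _ _ HN).
          + apply (nc_ext _ _ HN (Xn n) _ eta); auto; [|lra]. intros; ring. }
      split; [auto|].
      replace (eta / 2 * (1/2) ^ (S n)) with (eta / 2 * (1/2) ^ n / 2) by (simpl; field).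
      now apply (Hlip (Xn (S n)) (Xn n)). }
  assert (Hex : forall s, exists l, Rabs s <= r ->
    sums_to (fun n => Cminus (Xn (S n) s) (Xn n s)) l).
  { intros s. destruct (Rle_dec (Rabs s) r) as [Hs|]; [|exists (RtoC 0); tauto].
    destruct (dominated_sums_to (fun n => Cminus (Xn (S n) s) (Xn n s))
      (fun n => eta / 2 * (1/2) ^ n) (eta / 2 * 2)) as [l Hl].
    - intros n. apply (nc_sup _ _ HN _ _ s (proj2 (Hinv n)) Hs).
    - intros n. rewrite rsum_scal. apply Rmult_le_compat_l; [lra | apply rsum_geom].
    - exists l. auto. }
  apply choice in Hex as [X HX].
  assert (HXn : ps_norm r X eta).
  { apply (nc_series _ _ HN (fun n s => Cminus (Xn (S n) s) (Xn n s))
      (fun n => eta / 2 * (1/2) ^ n)); auto.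
    - intros n. apply Hinv.
    - intros n. rewrite rsum_scal.
      eapply Rle_trans; [apply Rmult_le_compat_l; [lra | apply rsum_geom] | lra]. }
  exists X. split; [auto|]. intros s Hs.
  assert (HXs : Cmod (X s) <= eta) by (apply (nc_sup _ _ HN _ _ s HXn Hs)).
  assert (Hfix : T s (X s) = X s).
  { apply Cmod_small_eq. intros eps Heps.
    destruct (sums_to_telescope (fun n => Xn n s) (X s) (HX s Hs) (eps/2) ltac:(lra)) as [N HNn].
    pose proof (HNn N ltac:(lia)) as H1. pose proof (HNn (S N) ltac:(lia)) as H2.
    replace (Cplus (Xn O s) (X s)) with (X s) in H1, H2 by (unfold Xn; simpl; ring).
    pose proof (Hpt s Hs (X s) (Xn N s) HXs (nc_sup _ _ HN _ _ s (proj1 (Hinv N)) Hs)) as H3.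
    change (T s (Xn N s)) with (Xn (S N) s) in H3.
    pose proof (Cmod_minus_triangle (T s (X s)) (Xn (S N) s) (X s)).
    rewrite (Cmod_minus_sym (X s) (Xn N s)) in H3. lra. }
  split; [auto|]. intros x Hx Tx.
  pose proof (Hpt s Hs x (X s) Hx HXs) as H. rewrite Tx, Hfix in H.
  apply Cminus_eq_0, Cmod_eq_0. pose proof (Cmod_ge_0 (Cminus x (X s))). lra.
Qed.

Lemma csum_tail_le (u : nat -> C) (w : nat -> R) i q :
  (forall j, (j < i)%nat -> u j = RtoC 0) ->
  (forall j, (i < j)%nat -> Cmod (u j) <= q * w j) -> 0 <= q -> (forall j, 0 <= w j) ->
  forall n, Cmod (Cminus (csum u (S i + n)%nat) (u i)) <= q * rsum w (S i + n)%nat.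
Proof.
  intros H0 Hu Hq Hw. induction n as [|n IH].
  - rewrite Nat.add_0_r.
    assert (E : csum u i = RtoC 0).
    { rewrite (csum_ext u (fun _ => RtoC 0)) by auto.
      clear. induction i as [|i IH]; simpl; [auto | rewrite IH; ring]. }
    simpl csum. rewrite E.
    replace (Cminus (Cplus (RtoC 0) (u i)) (u i)) with (RtoC 0) by ring. rewrite Cmod_0.
    apply Rmult_le_pos; auto. apply (rsum_incr w 0 (S i)); [auto | lia].
  - rewrite Nat.add_succ_r. specialize (Hu (S i + n)%nat ltac:(lia)).
    change (csum u (S (S i + n))) with (Cplus (csum u (S i + n)) (u (S i + n)%nat)).
    change (rsum w (S (S i + n))) with (rsum w (S i + n) + w (S i + n)%nat).
    replace (Cminus (Cplus (csum u (S i + n)) (u (S i + n)%nat)) (u i))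
      with (Cplus (Cminus (csum u (S i + n)) (u i)) (u (S i + n)%nat)) by ring.
    eapply Rle_trans; [apply Cmod_triangle|]. lra.
Qed.

(* Isolated zeros: if the first nonzero coefficient were [a i], then [g s = a i s^i + O(s^(i+1))]. *)
Lemma ps_norm_identity r g M : 0 < r -> ps_norm r g M ->
  (forall eps, 0 < eps -> exists s, 0 < Rabs s < eps /\ g s = RtoC 0) ->
  forall s, Rabs s <= r -> g s = RtoC 0.
Proof.
  intros Hr [a [Ha1 Ha2]] Hz.
  assert (HM : 0 <= M) by apply (Ha1 O).
  assert (Hai : forall i, a i = RtoC 0).
  { intros i. induction i as [i IH] using lt_wf_ind.
    apply Cmod_eq_0. apply Rle_antisym; [|apply Cmod_ge_0].
    apply le_epsilon. intros eps Heps. rewrite Rplus_0_l.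
    assert (Hri : 0 < r ^ S i) by now apply pow_lt.
    (* At a zero [s] the bound reads [Cmod (a i) <= Rabs s * M / r ^ S i], and this choice of [s]
       makes the right side at most [eps]. The [M + 1] avoids dividing by 0. *)
    destruct (Hz (Rmin r (eps * r ^ S i / (M + 1)))) as [s [[Hs0 Hs] Hgs]].
    { apply Rmin_glb_lt; auto. apply Rdiv_lt_0_compat; [apply Rmult_lt_0_compat|]; lra. }
    assert (Hsr : Rabs s <= r) by (left; eapply Rlt_le_trans; [apply Hs | apply Rmin_l]).
    assert (Hsi : 0 < Rabs s ^ i) by now apply pow_lt.
    set (q := Rabs s / r). assert (Hq : 0 <= q <= 1).
    { unfold q. split.
      - apply Rmult_le_pos; [lra|]. left. now apply Rinv_0_lt_compat.
      - apply Rmult_le_reg_r with r; auto. field_simplify; lra. }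
    assert (Hqr : forall j, Rabs s ^ j = q ^ j * r ^ j).
    { intros j. rewrite <- Rpow_mult_distr. f_equal. unfold q. field. lra. }
    assert (Hpart : forall n, Cmod (Cminus
        (csum (fun i => Cmult (a i) (Cpow (RtoC s) i)) (S i + n)%nat)
        (Cmult (a i) (Cpow (RtoC s) i)))
      <= q ^ S i * rsum (fun i => Cmod (a i) * r ^ i) (S i + n)%nat).
    { apply (csum_tail_le (fun i => Cmult (a i) (Cpow (RtoC s) i))).
      - intros j Hj. rewrite IH by auto. ring.
      - intros j Hj. rewrite Cmod_mult, Cmod_pow, Cmod_R, Hqr.
        replace j with (S i + (j - S i))%nat at 2 by lia. rewrite (pow_add q).
        set (n := (j - S i)%nat).
        assert (q ^ n <= 1) by (rewrite <- (pow1 n); apply pow_incr; lra).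
        assert (0 <= q ^ n) by (apply pow_le; lra).
        assert (0 <= q ^ S i) by (apply pow_le; lra).
        assert (0 <= Cmod (a j) * r ^ j)
          by (apply Rmult_le_pos; [apply Cmod_ge_0 | left; now apply pow_lt]).
        assert (0 <= q ^ S i * (Cmod (a j) * r ^ j)) by now apply Rmult_le_pos.
        nra.
      - apply pow_le; lra.
      - intros j. apply Rmult_le_pos; [apply Cmod_ge_0 | left; now apply pow_lt]. }
    assert (Hb : Cmod (Cminus (g s) (Cmult (a i) (Cpow (RtoC s) i))) <= q ^ S i * M).
    { apply (sums_to_close _ _ _ _ (Ha2 s Hsr)). exists (S i). intros n Hn.
      replace n with (S i + (n - S i))%nat by lia.
      eapply Rle_trans; [apply Hpart|]. apply Rmult_le_compat_l; auto. apply pow_le; lra. }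
    rewrite Hgs, Cmod_minus_sym in Hb.
    replace (Cminus (Cmult (a i) (Cpow (RtoC s) i)) (RtoC 0))
      with (Cmult (a i) (Cpow (RtoC s) i)) in Hb by ring.
    rewrite Cmod_mult, Cmod_pow, Cmod_R in Hb.
    apply Rmult_le_reg_r with (Rabs s ^ i * r ^ S i); [apply Rmult_lt_0_compat; auto|].
    apply Rle_trans with (Rabs s ^ S i * M).
    - rewrite (Hqr (S i)). nra.
    - assert (Hse : Rabs s * (M + 1) <= eps * r ^ S i).
      { apply Rle_trans with (eps * r ^ S i / (M + 1) * (M + 1)).
        - apply Rmult_le_compat_r; [lra|]. left. eapply Rlt_le_trans; [apply Hs | apply Rmin_r].
        - right. field. lra. }
      replace (Rabs s ^ S i) with (Rabs s * Rabs s ^ i) by reflexivity. nra. }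
  intros s Hs. apply (sums_to_unique _ _ _ (Ha2 s Hs)).
  intros eps Heps. exists O. intros n _.
  rewrite (csum_ext _ (fun _ => RtoC 0)).
  - replace (csum (fun _ => RtoC 0) n) with (RtoC 0).
    + replace (Cminus (RtoC 0) (RtoC 0)) with (RtoC 0) by ring. now rewrite Cmod_0.
    + clear. induction n as [|n IH]; simpl; [auto | rewrite <- IH; ring].
  - intros i _. rewrite Hai. ring.
Qed.

(** On real arguments the conjugate of [X] is again a power series, with conjugated coefficients.
    Its difference from [X] vanishes at points accumulating at 0, hence identically. *)
Lemma ps_norm_real r X M : 0 < r -> ps_norm r X M ->
  (forall eps, 0 < eps -> exists s, 0 < Rabs s < eps /\ Im (X s) = 0) ->
  forall s, Rabs s <= r -> X s = RtoC (Re (X s)).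
Proof.
  intros Hr HX Hz s Hs. pose proof (ps_norm_class r Hr) as HN.
  assert (HXc : ps_norm r (fun s => Cconj (X s)) M).
  { destruct HX as [a [Ha1 Ha2]]. exists (fun i => Cconj (a i)). split.
    - intros n. rewrite (rsum_ext _ (fun i => Cmod (a i) * r ^ i)); auto.
      intros i _. now rewrite Cmod_conj.
    - intros t Ht. eapply sums_to_ext; [|apply sums_to_conj, Ha2, Ht].
      intros i. cbv beta. rewrite Cmult_conj. f_equal. rewrite Cpow_conj. f_equal.
      unfold Cconj, RtoC; simpl. f_equal. ring. }
  pose proof (ps_norm_identity r _ _ Hr (nc_minus _ _ HN _ _ _ _ HX HXc)) as H.
  cbv beta in H. specialize (fun h => H h s Hs). apply (f_equal Im) in H.
  - destruct (X s) as [x y]. unfold Cconj, Cminus, Cplus, Copp, Im, Re, RtoC in *. simpl in *.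
    f_equal. lra.
  - intros eps Heps. destruct (Hz eps Heps) as [t [Ht Hi]]. exists t. split; [auto|].
    destruct (X t) as [x y]. unfold Cconj, Cminus, Cplus, Copp, Im, RtoC in *. simpl in *.
    f_equal; lra.
Qed.

(** For real [s], taking real parts of the coefficients gives a real power series with sum
    [Re (X s)]; the norm bound puts its radius of convergence at [r] or more. *)
Lemma ps_norm_Re_continuous r X M s : 0 < r -> ps_norm r X M -> Rabs s < r ->
  continuity_pt (fun s => Re (X s)) s.
Proof.
  intros Hr [a [Ha1 Ha2]] Hs.
  assert (HRe : forall (u : nat -> C) n, Re (csum u (S n)) = sum_n (fun i => Re (u i)) n).
  { intros u n. rewrite sum_n_rsum. generalize (S n) as k. clear.
    induction k as [|k IH]; [reflexivity|]. simpl. rewrite <- IH. reflexivity. }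
  assert (Hser : forall t, Rabs t <= r -> is_pseries (fun i => Re (a i)) t (Re (X t))).
  { intros t Ht. apply is_pseries_R. unfold is_series.
    apply filterlim_locally. intros eps.
    destruct (Ha2 t Ht eps (cond_pos eps)) as [N HN]. exists N. intros n Hn.
    specialize (HN (S n) ltac:(lia)).
    pose proof (re_le_Cmod (Cminus (csum (fun i => Cmult (a i) (Cpow (RtoC t) i)) (S n)) (X t))) as H.
    change (Rabs (sum_n (fun n => Re (a n) * t ^ n) n - Re (X t)) < eps).
    replace (sum_n (fun n => Re (a n) * t ^ n) n)
      with (Re (csum (fun i => Cmult (a i) (Cpow (RtoC t) i)) (S n))).
    - eapply Rle_lt_trans; [|apply HN]. apply H.
    - rewrite HRe. apply sum_n_ext. intros i. rewrite <- RtoC_pow.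
      unfold Cmult, Re, RtoC. simpl. ring. }
  assert (Hcv : Rbar_lt (Rabs s) (CV_radius (fun i => Re (a i)))).
  { apply Rbar_lt_le_trans with r; [exact Hs|].
    apply (proj1 (CV_radius_bounded (fun i => Re (a i)))). exists M. intros n.
    rewrite Rabs_mult. rewrite (Rabs_right (r ^ n)) by (left; now apply pow_lt).
    eapply Rle_trans; [apply Rmult_le_compat_r; [left; now apply pow_lt | apply re_le_Cmod]|].
    eapply Rle_trans; [|apply (Ha1 (S n))].
    apply (rsum_term (fun i => Cmod (a i) * r ^ i)). intros i.
    apply Rmult_le_pos; [apply Cmod_ge_0 | left; now apply pow_lt]. }
  apply continuity_pt_ext_loc with (PSeries (fun i => Re (a i))).
  - assert (Hloc : forall t : R, Rabs (t - s) < r - Rabs s ->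
      PSeries (fun i => Re (a i)) t = Re (X t)).
    { intros t Ht. apply is_pseries_unique, Hser.
      pose proof (Rabs_triang (t - s) s) as H. replace (t - s + s) with t in H by ring. lra. }
    exists (mkposreal (r - Rabs s) ltac:(lra)). exact Hloc.
  - now apply PSeries_continuity.
Qed.

(** * Germs of real-analytic curves and their leading terms *)

Definition germ (g : R -> C) : Prop :=
  exists R0 (A : nat -> C), 0 < R0 /\ forall x, Rabs x < R0 ->
    sums_to (fun n => Cmult (A n) (Cpow (RtoC x) n)) (g x).

Definition injective_near0 (g : R -> C) : Prop :=
  exists d, 0 < d /\ forall x y, Rabs x < d -> Rabs y < d -> g x = g y -> x = y.

Lemma sums_to_bounded u l : sums_to u l -> exists B, forall n, Cmod (u n) <= B.
Proof.
  intros H. destruct (H 1 ltac:(lra)) as [N HN].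
  exists (2 + rsum (fun i => Cmod (u i)) N). intros n.
  assert (0 <= rsum (fun i => Cmod (u i)) N)
    by (apply (rsum_incr _ 0 N); [intros; apply Cmod_ge_0 | lia]).
  destruct (le_lt_dec N n) as [Hn|Hn].
  - pose proof (HN n Hn) as H1. pose proof (HN (S n) ltac:(lia)) as H2.
    replace (u n) with (Cminus (Cminus (csum u (S n)) l) (Cminus (csum u n) l)) by (simpl; ring).
    pose proof (Cmod_minus_le (Cminus (csum u (S n)) l) (Cminus (csum u n) l)). lra.
  - pose proof (rsum_term (fun i => Cmod (u i)) n ltac:(intros; apply Cmod_ge_0)).
    pose proof (rsum_incr (fun i => Cmod (u i)) (S n) N ltac:(intros; apply Cmod_ge_0) Hn).
    cbv beta in *. lra.
Qed.

(** Injectivity excludes a constant germ, so some coefficient of positive index is nonzero; [k] is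
    the first such index. The cofactor [v] is defined on a complex disk, although [g] has only real
    arguments, because the unknown [X] is complex until it is proved real. *)
Lemma germ_order g : germ g -> injective_near0 g ->
  exists k c v a K rho, (1 <= k)%nat /\ c <> RtoC 0 /\ ps_sum v a K rho /\ v (RtoC 0) = RtoC 1 /\
  forall x, Rabs x <= rho -> g x = Cplus (g 0) (Cmult (Cmult c (Cpow (RtoC x) k)) (v (RtoC x))).
Proof.
  intros [R0 [A [HR HA]]] [d [Hd Hinj]].
  assert (Hpow0 : forall n, Cpow (RtoC 0) (S n) = RtoC 0) by (intros; simpl; ring).
  assert (Hconst : forall (u : nat -> C) c, u O = c -> (forall n, u (S n) = RtoC 0) -> sums_to u c).
  { intros u c H0 HS eps Heps. exists 1%nat. intros [|n] Hn; [lia|].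
    replace (csum u (S n)) with c.
    - replace (Cminus c c) with (RtoC 0) by ring. now rewrite Cmod_0.
    - clear Hn. induction n as [|n IH]; [simpl; rewrite H0; ring|].
      change (c = Cplus (csum u (S n)) (u (S n))). rewrite <- IH, HS. ring. }
  assert (Hg0 : g 0 = A O).
  { apply (sums_to_unique (fun n => Cmult (A n) (Cpow (RtoC 0) n))).
    - apply HA. rewrite Rabs_R0. auto.
    - apply Hconst; [simpl; ring|]. intros n. rewrite Hpow0. ring. }
  assert (Hk : exists k, (1 <= k)%nat /\ A k <> RtoC 0 /\
    forall j, (1 <= j < k)%nat -> A j = RtoC 0).
  { destruct (classic (exists k, (1 <= k)%nat /\ A k <> RtoC 0)) as [[k Hk]|Hno].
    - induction k as [k IH] using lt_wf_ind.
      destruct (classic (exists j, (j < k)%nat /\ (1 <= j)%nat /\ A j <> RtoC 0)) as [[j [Hj1 Hj2]]|Hj].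
      + apply (IH j); auto.
      + exists k. repeat split; try tauto. intros j Hjk. apply NNPP. intros E.
        apply Hj. exists j. repeat split; [lia | lia | auto].
    - exfalso.
      assert (Hg : forall x, Rabs x < R0 -> g x = A O).
      { intros x Hx. apply (sums_to_unique _ _ _ (HA x Hx)).
        apply Hconst; [simpl; ring|]. intros n.
        replace (A (S n)) with (RtoC 0); [ring|]. symmetry. apply NNPP. intros E.
        apply Hno. exists (S n). split; [lia | auto]. }
      set (x := Rmin d R0 / 2).
      assert (0 < x /\ x < d /\ x < R0).
      { unfold x. assert (0 < Rmin d R0) by now apply Rmin_glb_lt.
        pose proof (Rmin_l d R0). pose proof (Rmin_r d R0). lra. }
      assert (Rabs x = x) by (apply Rabs_right; lra).
      assert (E : x = 0).
      { apply Hinj; [lra | rewrite Rabs_R0; auto |].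
        rewrite !Hg; auto; [rewrite Rabs_R0; auto | lra]. }
      lra. }
  destruct Hk as [k [Hk1 [Hk2 Hk3]]].
  (* [4 * rho = R0 / 2] lies inside the interval of convergence. The terms of the series at that
     point are bounded, which is the coefficient bound required by [ps_sum]. *)
  set (rho := R0 / 8).
  assert (Hrho : 0 < rho) by (unfold rho; lra).
  destruct (sums_to_bounded (fun n => Cmult (A n) (Cpow (RtoC (4 * rho)) n)) (g (4 * rho))) as [B HB].
  { apply HA. unfold rho. rewrite Rabs_right; lra. }
  assert (HB' : forall n, Cmod (A n) * (4 * rho) ^ n <= B).
  { intros n. specialize (HB n). rewrite Cmod_mult, Cmod_pow, Cmod_R, Rabs_right in HB; lra. }
  set (a := fun n => Cdiv (A (k + n)%nat) (A k)).
  assert (HAk : 0 < Cmod (A k)) by now apply Cmod_gt_0.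
  assert (Hrk : 0 < (4 * rho) ^ k) by (apply pow_lt; lra).
  set (K := B / (Cmod (A k) * (4 * rho) ^ k)).
  assert (Ha : forall n, Cmod (a n) * (4 * rho) ^ n <= K).
  { intros n. unfold a, K. rewrite Cmod_div by auto.
    apply Rmult_le_reg_r with (Cmod (A k) * (4 * rho) ^ k); [now apply Rmult_lt_0_compat|].
    replace (B / (Cmod (A k) * (4 * rho) ^ k) * (Cmod (A k) * (4 * rho) ^ k)) with B
      by (field; split; lra).
    specialize (HB' (k + n)%nat). rewrite pow_add in HB'.
    replace (Cmod (A (k + n)%nat) / Cmod (A k) * (4 * rho) ^ n * (Cmod (A k) * (4 * rho) ^ k))
      with (Cmod (A (k + n)%nat) * ((4 * rho) ^ k * (4 * rho) ^ n)) by (field; lra).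
    exact HB'. }
  assert (HK : 0 <= K).
  { specialize (Ha O). simpl in Ha. pose proof (Cmod_ge_0 (a O)). lra. }
  assert (Hv : forall y, exists l, Cmod y <= rho -> sums_to (fun n => Cmult (a n) (Cpow y n)) l).
  { intros y. destruct (Rle_dec (Cmod y) rho) as [Hy|]; [|exists (RtoC 0); tauto].
    destruct (dominated_sums_to (fun n => Cmult (a n) (Cpow y n))
      (fun n => K * (1/2) ^ n) (K * 2)) as [l Hl].
    - intros n. rewrite Cmod_mult, Cmod_pow.
      apply Rle_trans with (Cmod (a n) * ((4 * rho) ^ n * (1/2) ^ n)).
      + apply Rmult_le_compat_l; [apply Cmod_ge_0|]. rewrite <- Rpow_mult_distr.
        apply pow_incr. split; [apply Cmod_ge_0 | lra].
      + rewrite <- Rmult_assoc. apply Rmult_le_compat_r; auto. apply pow_le; lra.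
    - intros n. rewrite rsum_scal. apply Rmult_le_compat_l; auto. apply rsum_geom.
    - exists l. auto. }
  apply choice in Hv as [v Hv].
  exists k, (A k), v, a, K, rho. split; [auto|]. split; [auto|].
  split; [now repeat split|]. split.
  - apply (sums_to_unique (fun n => Cmult (a n) (Cpow (RtoC 0) n))).
    + apply Hv. rewrite Cmod_0. lra.
    + apply Hconst.
      * unfold a. rewrite Nat.add_0_r. simpl. field. auto.
      * intros n. rewrite Hpow0. ring.
  - intros x Hx.
    apply (sums_to_unique (fun n => Cmult (A n) (Cpow (RtoC x) n))).
    { apply HA. unfold rho in Hx. lra. }
    rewrite Hg0.
    assert (Hsplit : forall n, csum (fun n => Cmult (A n) (Cpow (RtoC x) n)) (k + n)%nat =
      Cplus (A O) (Cmult (Cmult (A k) (Cpow (RtoC x) k))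
        (csum (fun n => Cmult (a n) (Cpow (RtoC x) n)) n))).
    { induction n as [|n IH].
      - rewrite Nat.add_0_r. simpl csum at 2.
        replace (Cplus (A O) (Cmult (Cmult (A k) (Cpow (RtoC x) k)) (RtoC 0))) with (A O) by ring.
        destruct k as [|k]; [lia|]. clear - Hk3.
        induction k as [|k IH]; [simpl; ring|].
        change (Cplus (csum (fun n => Cmult (A n) (Cpow (RtoC x) n)) (S k))
          (Cmult (A (S k)) (Cpow (RtoC x) (S k))) = A O).
        rewrite IH by (intros; apply Hk3; lia). rewrite (Hk3 (S k)) by lia. ring.
      - rewrite Nat.add_succ_r.
        change (csum (fun n => Cmult (A n) (Cpow (RtoC x) n)) (S (k + n)))
          with (Cplus (csum (fun n => Cmult (A n) (Cpow (RtoC x) n)) (k + n))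
                  (Cmult (A (k + n)%nat) (Cpow (RtoC x) (k + n)))).
        rewrite IH. simpl csum. unfold a at 3. rewrite Cpow_add_r. field. auto. }
    specialize (Hv (RtoC x)). rewrite Cmod_R in Hv. specialize (Hv Hx).
    apply (sums_to_scal (Cmult (A k) (Cpow (RtoC x) k))) in Hv.
    intros eps Heps. destruct (Hv eps Heps) as [N HN]. exists (k + N)%nat. intros n Hn.
    replace n with (k + (n - k))%nat by lia. rewrite Hsplit.
    specialize (HN (n - k)%nat ltac:(lia)). rewrite csum_scal in HN.
    match goal with |- Cmod ?z < _ => match type of HN with Cmod ?w < _ =>
      replace z with w by ring end end. exact HN.
Qed.

Lemma pos_root x n : 0 < x -> (1 <= n)%nat -> exists s, 0 < s /\ s ^ n = x.
Proof.
  intros Hx Hn. exists (Rpower x (/ INR n)). split; [apply exp_pos|].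
  rewrite <- Rpower_pow by apply exp_pos.
  rewrite Rpower_mult, Rinv_l, Rpower_1; auto.
  apply not_0_INR. lia.
Qed.

Lemma pow_lt_reg s t n : 0 <= t -> s ^ n < t ^ n -> s < t.
Proof.
  intros Ht H. apply Rnot_le_lt. intros Hle.
  pose proof (pow_incr t s n (conj Ht Hle)). lra.
Qed.

(** Turns closeness of [Z ^ m] to 1 into closeness of the positive root [Z], so that a real solution
    falls in the disk where the fixed point is unique. *)
Lemma Rabs_minus_one_le_pow Z m : 0 < Z -> (1 <= m)%nat -> Rabs (Z - 1) <= Rabs (Z ^ m - 1).
Proof.
  intros HZ Hm. destruct m as [|m]; [lia|]. simpl.
  destruct (Rle_lt_dec 1 Z) as [H|H].
  - assert (1 <= Z ^ m) by now apply pow_R1_Rle.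
    rewrite !Rabs_right by nra. nra.
  - assert (Z ^ m <= 1) by (rewrite <- (pow1 m); apply pow_incr; lra).
    assert (0 < Z ^ m) by now apply pow_lt.
    rewrite !Rabs_left by nra. nra.
Qed.

(** With [g] the gcd, [n = m / g] and [p = k / g]; if both were even, [2 * g] would be a common
    divisor of [k] and [m]. *)
Lemma reduced_exponents k m : (1 <= k)%nat -> (1 <= m)%nat ->
  exists n p, (1 <= n)%nat /\ (1 <= p)%nat /\ (n * k = p * m)%nat /\ (Nat.Odd n \/ Nat.Odd p).
Proof.
  intros Hk Hm. set (g := Nat.gcd k m).
  destruct (Nat.gcd_divide_l k m) as [p Hp]. destruct (Nat.gcd_divide_r k m) as [n Hn].
  fold g in Hp, Hn.
  assert (1 <= g)%nat by (destruct g; lia).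
  exists n, p. repeat split; try nia.
  destruct (Nat.Even_or_Odd n) as [[n' En]|]; [|auto].
  destruct (Nat.Even_or_Odd p) as [[p' Ep]|]; [|auto].
  exfalso.
  assert (Hdiv : Nat.divide (2 * g) g).
  { apply Nat.gcd_greatest; [exists p' | exists n']; nia. }
  apply Nat.divide_pos_le in Hdiv; lia.
Qed.

(** Applied to the ratio of the leading coefficients of two intersecting germs, which then has a
    positive real [m]-th root. *)
Lemma Cpositive_limit (z : C) : z <> RtoC 0 ->
  (forall eps, 0 < eps -> exists t, 0 < t /\ Cmod (Cminus (RtoC t) z) <= eps) ->
  exists q, 0 < q /\ z = RtoC q.
Proof.
  intros Hz H. destruct z as [x y].
  assert (Hxy : forall eps, 0 < eps -> Rabs y <= eps /\ - eps <= x).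
  { intros eps Heps. destruct (H eps Heps) as [t [Ht Hm]].
    pose proof (Rmax_Cmod (Cminus (RtoC t) (x, y))) as Hmax.
    replace (fst (Cminus (RtoC t) (x, y))) with (t - x) in Hmax by (simpl; ring).
    replace (snd (Cminus (RtoC t) (x, y))) with (- y) in Hmax by (simpl; ring).
    rewrite Rabs_Ropp in Hmax.
    pose proof (Rmax_l (Rabs (t - x)) (Rabs y)). pose proof (Rmax_r (Rabs (t - x)) (Rabs y)).
    assert (Hb : Rabs (t - x) <= eps) by lra. apply Rabs_le_between in Hb. lra. }
  assert (Hy : y = 0).
  { apply Rabs_eq_0. apply Rle_antisym; [|apply Rabs_pos]. apply le_epsilon.
    intros eps Heps. destruct (Hxy eps Heps). lra. }
  assert (Hx : 0 <= x).
  { apply le_epsilon. intros eps Heps. destruct (Hxy eps Heps). lra. }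
  subst y. exists x. split; [|reflexivity].
  destruct Hx as [Hx|Hx]; [auto|]. exfalso. apply Hz. now rewrite <- Hx.
Qed.

Lemma ps_sum_near_one v a K rho y : ps_sum v a K rho -> v (RtoC 0) = RtoC 1 -> Cmod y <= rho ->
  Cmod (Cminus (v y) (RtoC 1)) <= 2 * K / rho * Cmod y.
Proof.
  intros Hps H0 Hy. pose proof (proj1 Hps) as Hrho.
  pose proof (nc_comp_lip _ _ (point_norm_class 0) v a K rho (fun _ => y) (fun _ => RtoC 0)
    (Cmod y) Hps Hy) as H.
  cbv beta in H. rewrite Cmod_0 in H. rewrite <- H0. apply H; [lra|].
  replace (Cminus y (RtoC 0)) with y by ring. lra.
Qed.

Lemma Rmin_pos_le a b : 0 < a -> 0 < b -> exists d, 0 < d /\ d <= a /\ d <= b.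
Proof.
  intros. exists (Rmin a b). split; [now apply Rmin_glb_lt|].
  split; [apply Rmin_l | apply Rmin_r].
Qed.

Lemma lip_small L eps : 0 <= L -> 0 < eps -> exists d, 0 < d /\ forall t, 0 <= t <= d -> L * t <= eps.
Proof.
  intros HL He. exists (eps / (L + 1)). split; [apply Rdiv_lt_0_compat; lra|].
  intros t Ht. apply Rle_trans with (L * (eps / (L + 1))).
  - apply Rmult_le_compat_l; lra.
  - apply Rmult_le_reg_r with (L + 1); [lra|]. field_simplify; [|lra]. nra.
Qed.

Lemma ps_sum_lip_ge0 v a K rho : ps_sum v a K rho -> 0 <= 2 * K / rho.
Proof.
  intros H. pose proof (ps_sum_K_ge0 _ _ _ _ H). destruct H as [H _].
  apply Rmult_le_pos; [lra|]. left. now apply Rinv_0_lt_compat.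
Qed.

Lemma ps_sum_tends_to_one v a K rho eps : ps_sum v a K rho -> v (RtoC 0) = RtoC 1 -> 0 < eps ->
  exists d, 0 < d /\ d <= rho /\ forall y, Cmod y <= d -> Cmod (Cminus (v y) (RtoC 1)) <= eps.
Proof.
  intros Hps H0 He.
  destruct (lip_small _ eps (ps_sum_lip_ge0 _ _ _ _ Hps) He) as [d1 [Hd1 HL]].
  destruct (Rmin_pos_le d1 rho Hd1 (proj1 Hps)) as [d [Hd [Hda Hdb]]].
  exists d. repeat split; auto. intros y Hy.
  eapply Rle_trans; [eapply ps_sum_near_one; eauto; lra|].
  apply HL. split; [apply Cmod_ge_0 | lra].
Qed.

(** Each coincidence [x], [y] is read with [s] the positive [n]-th root of [x] and [Y = y / s^p].
    Both sides then contain [s^(n k) = s^(p m)], which cancels and leaves an equation whose factors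
    [u] and [v] tend to 1. *)
Lemma intersections_rescaled k c u a K rho m e v b L sig n p :
  (1 <= k)%nat -> (1 <= m)%nat -> (1 <= n)%nat -> (1 <= p)%nat -> (n * k = p * m)%nat ->
  ps_sum u a K rho -> u (RtoC 0) = RtoC 1 -> ps_sum v b L sig -> v (RtoC 0) = RtoC 1 ->
  (forall eps, 0 < eps -> exists x y, 0 < x < eps /\ 0 < y < eps /\
     Cmult (Cmult c (Cpow (RtoC x) k)) (u (RtoC x)) =
     Cmult (Cmult e (Cpow (RtoC y) m)) (v (RtoC y))) ->
  forall eps, 0 < eps -> exists s Y, 0 < s < eps /\ 0 < Y /\
    Cmult c (u (RtoC (s ^ n))) = Cmult (Cmult e (RtoC (Y ^ m))) (v (RtoC (s ^ p * Y))) /\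
    Cmod (Cminus (u (RtoC (s ^ n))) (RtoC 1)) <= eps /\
    Cmod (Cminus (v (RtoC (s ^ p * Y))) (RtoC 1)) <= eps.
Proof.
  intros Hk Hm Hn Hp Hnk Hu Hu0 Hv Hv0 Hsol eps Heps.
  destruct (ps_sum_tends_to_one _ _ _ _ eps Hu Hu0 Heps) as [d1 [Hd1 [_ H1]]].
  destruct (ps_sum_tends_to_one _ _ _ _ eps Hv Hv0 Heps) as [d2 [Hd2 [_ H2]]].
  assert (Hen : 0 < eps ^ n) by now apply pow_lt.
  destruct (Rmin_pos_le d1 d2 Hd1 Hd2) as [d3 [Hd3 [Ha3 Hb3]]].
  destruct (Rmin_pos_le d3 (eps ^ n) Hd3 Hen) as [d [Hd [Ha Hb]]].
  destruct (Hsol d Hd) as [x [y [Hx [Hy E]]]].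
  destruct (pos_root x n ltac:(lra) Hn) as [s [Hs Hsx]].
  assert (Hsp : 0 < s ^ p) by now apply pow_lt.
  exists s, (y / s ^ p).
  replace (s ^ p * (y / s ^ p)) with y by (field; lra). rewrite Hsx.
  split; [split; [auto|apply pow_lt_reg with n; lra]|].
  split; [apply Rdiv_lt_0_compat; lra|]. split; [|split].
  - assert (Hnz : RtoC (s ^ (n * k)) <> RtoC 0).
    { intros H. apply RtoC_inj in H. assert (0 < s ^ (n * k)) by now apply pow_lt. lra. }
    rewrite <- !RtoC_pow in E.
    replace (x ^ k) with (s ^ (n * k)) in E by (now rewrite <- Hsx, pow_mult).
    replace (y ^ m) with ((y / s ^ p) ^ m * s ^ (n * k)) in E.
    + rewrite RtoC_mult in E.
      transitivity (Cdiv (Cmult (Cmult c (RtoC (s ^ (n * k)))) (u (RtoC x))) (RtoC (s ^ (n * k))));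
        [field; auto|]. rewrite E. field. auto.
    + rewrite Hnk, pow_mult, <- Rpow_mult_distr. f_equal. field. lra.
  - apply H1. rewrite Cmod_R, Rabs_right; lra.
  - apply H2. rewrite Cmod_R, Rabs_right; lra.
Qed.

Lemma ratio_near_one (u v : C) eps : eps <= 1/2 ->
  Cmod (Cminus u (RtoC 1)) <= eps -> Cmod (Cminus v (RtoC 1)) <= eps ->
  v <> RtoC 0 /\ Cmod (Cminus (Cdiv u v) (RtoC 1)) <= 4 * eps.
Proof.
  intros He Hu Hv.
  pose proof (Cmod_le_plus (RtoC 1) v) as H. rewrite Cmod_1, Cmod_minus_sym in H.
  assert (Hv2 : 1/2 <= Cmod v) by lra.
  assert (Hv0 : v <> RtoC 0) by (apply Cmod_gt_0; lra).
  split; [auto|].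
  replace (Cminus (Cdiv u v) (RtoC 1))
    with (Cdiv (Cminus (Cminus u (RtoC 1)) (Cminus v (RtoC 1))) v) by (field; auto).
  rewrite Cmod_div by auto.
  pose proof (Cmod_minus_le (Cminus u (RtoC 1)) (Cminus v (RtoC 1))).
  apply Rmult_le_reg_r with (Cmod v); [lra|].
  unfold Rdiv. rewrite Rmult_assoc, Rinv_l, Rmult_1_r by lra.
  assert (0 <= eps) by (eapply Rle_trans; [apply Cmod_ge_0 | apply Hu]). nra.
Qed.

(* The real branch comes from the substitution x = s^n, y = rho0 s^p (1 + X(s)) with n k = p m,
   which turns the intersection equation into a nondegenerate one for X. *)
Lemma intersection_branch g h : germ g -> germ h -> injective_near0 g -> injective_near0 h ->
  g 0 = h 0 ->
  (forall eps, 0 < eps -> exists x y, 0 < x < eps /\ 0 < y < eps /\ g x = h y) ->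
  exists n r W, Nat.Odd n /\ 0 < r /\ W 0 = 0 /\
    (forall s, Rabs s < r -> continuity_pt W s) /\
    forall s, Rabs s < r -> g (s ^ n) = h (W s).
Proof.
  intros Gg Gh Ig Ih E0 Hsol.
  destruct (germ_order g Gg Ig) as (k & c & u & a & K & rho & Hk & Hc & Hu & Hu0 & Eg).
  destruct (germ_order h Gh Ih) as (m & e & v & b & L & sig & Hm & He & Hv & Hv0 & Eh).
  destruct (reduced_exponents k m Hk Hm) as (n & p & Hn & Hp & Hnk & Hodd).
  pose proof (proj1 Hu) as Hrho. pose proof (proj1 Hv) as Hsig.
  assert (Hsol2 := intersections_rescaled k c u a K rho m e v b L sig n p Hk Hm Hn Hp Hnk
    Hu Hu0 Hv Hv0). clear Gg Gh.
  assert (Hres : forall eps, 0 < eps -> exists s Y, 0 < s < eps /\ 0 < Y /\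
    Cmult c (u (RtoC (s ^ n))) = Cmult (Cmult e (RtoC (Y ^ m))) (v (RtoC (s ^ p * Y))) /\
    Cmod (Cminus (u (RtoC (s ^ n))) (RtoC 1)) <= eps /\
    Cmod (Cminus (v (RtoC (s ^ p * Y))) (RtoC 1)) <= eps).
  { apply Hsol2. intros eps Heps.
    destruct (Rmin_pos_le rho sig Hrho Hsig) as [d1 [Hd1 [A1 B1]]].
    destruct (Rmin_pos_le d1 eps Hd1 Heps) as [d [Hd [A2 B2]]].
    destruct (Hsol d Hd) as [x [y [Hx [Hy E]]]]. exists x, y.
    split; [lra|]. split; [lra|].
    rewrite (Eg x), (Eh y), E0 in E by (rewrite Rabs_right; lra).
    match type of E with Cplus _ ?A = Cplus _ ?B =>
      replace A with (Cminus (Cplus (h 0) A) (h 0)) by ring; rewrite E; ring end. }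
  clear Hsol Hsol2.
  (* The rescaled equation gives [Y^m = (c / e) (u / v)], where [u / v] tends to 1; so [c / e] is a
     limit of positive reals. *)
  assert (Hq : exists q, 0 < q /\ Cdiv c e = RtoC q).
  { apply Cpositive_limit.
    - intros E. apply Hc. replace c with (Cmult (Cdiv c e) e) by (field; auto). rewrite E. ring.
    - intros eps Heps.
      destruct (lip_small (Cmod (Cdiv c e) * 4) eps) as [d1 [Hd1 HL]]; auto.
      { pose proof (Cmod_ge_0 (Cdiv c e)). lra. }
      destruct (Rmin_pos_le d1 (1/2) Hd1 ltac:(lra)) as [d [Hd [A B]]].
      destruct (Hres d Hd) as (s & Y & Hs & HY & E & H1 & H2).
      destruct (ratio_near_one _ _ d B H1 H2) as [Hnz H3].
      exists (Y ^ m). split; [now apply pow_lt|].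
      assert (EY : RtoC (Y ^ m) =
        Cmult (Cdiv c e) (Cdiv (u (RtoC (s ^ n))) (v (RtoC (s ^ p * Y))))).
      { transitivity (Cdiv (Cmult (Cmult e (RtoC (Y ^ m))) (v (RtoC (s ^ p * Y))))
          (Cmult e (v (RtoC (s ^ p * Y))))); [field; auto|].
        rewrite <- E. field. auto. }
      rewrite EY.
      match goal with |- Cmod (Cminus (Cmult ?k ?q) ?k) <= _ =>
        replace (Cminus (Cmult k q) k) with (Cmult k (Cminus q (RtoC 1))) by ring end.
      rewrite Cmod_mult. eapply Rle_trans; [apply Rmult_le_compat_l; [apply Cmod_ge_0 | apply H3]|].
      rewrite <- Rmult_assoc. apply HL. lra. }
  destruct Hq as [q [Hq Eq]].
  assert (Ec : c = Cmult e (RtoC q)) by (rewrite <- Eq; field; auto).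
  destruct (pos_root q m Hq Hm) as [rho0 [Hrho0 Erho0]].
  destruct (newton_map_contracts m v b L sig 1 Hm Hv Hv0 ltac:(lra))
    as (eta & del & Heta & Heta2 & Hdel & Hcontr).
  (* [Cmod (P s) <= sig / 2] and [1 + Re (X s) <= 3/2] keep [W s] within [sig], where the expansion
     of [h] is valid. *)
  destruct (Rmin_pos_le del (sig / 2) Hdel ltac:(lra)) as [del' [Hdel' [Hd1 Hd2]]].
  destruct (lip_small rho0 del' ltac:(lra) Hdel') as [r1 [Hr1 HL1]].
  destruct (lip_small _ del (ps_sum_lip_ge0 _ _ _ _ Hu) Hdel) as [r2 [Hr2 HL2]].
  destruct (Rmin_pos_le r1 r2 Hr1 Hr2) as [r3 [Hr3 [A3 B3]]].
  destruct (Rmin_pos_le rho 1 Hrho ltac:(lra)) as [r4 [Hr4 [A4 B4]]].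
  destruct (Rmin_pos_le r3 r4 Hr3 Hr4) as [r [Hr [A5 B5]]].
  assert (Hpow : forall j t, (1 <= j)%nat -> 0 <= t <= r -> t ^ j <= t).
  { intros [|j] t Hj Ht; [lia|]. simpl.
    assert (t ^ j <= 1) by (rewrite <- (pow1 j); apply pow_incr; lra).
    assert (0 <= t ^ j) by (apply pow_le; lra). nra. }
  pose proof (ps_norm_class r Hr) as HN.
  set (P := fun s : R => RtoC (rho0 * s ^ p)).
  set (U := fun s : R => u (RtoC (s ^ n))).
  assert (Hmono : forall (c0 : R) j, 0 <= c0 -> (1 <= j)%nat ->
    ps_norm r (fun s => RtoC (c0 * s ^ j)) (c0 * r)).
  { intros c0 j Hc0 Hj.
    apply (nc_ext _ _ HN
      (fun s => Cmult (Cmult (RtoC c0) (Cpow (RtoC s) j)) (RtoC 1)) _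
      (Cmod (RtoC c0) * r ^ j * Cmod (RtoC 1))).
    - intros s _. rewrite RtoC_mult, RtoC_pow. ring.
    - rewrite Cmod_1, Cmod_R, Rabs_right by lra. rewrite Rmult_1_r.
      apply Rmult_le_compat_l; auto. apply Hpow; auto; lra.
    - apply ps_norm_monomial_mult; auto. apply (nc_const _ _ HN). }
  assert (HP' : ps_norm r P del').
  { apply (nc_ext _ _ HN P P (rho0 * r)); auto.
    - apply HL1. lra.
    - apply Hmono; auto. lra. }
  assert (HP : ps_norm r P del) by (apply (nc_ext _ _ HN P P del'); auto).
  assert (HU : ps_norm r (fun s => Cminus (U s) (RtoC 1)) del).
  { assert (Hsn : ps_norm r (fun s => RtoC (s ^ n)) r).
    { apply (nc_ext _ _ HN (fun s => RtoC (1 * s ^ n)) _ (1 * r)).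
      - intros s _. now rewrite Rmult_1_l.
      - lra.
      - apply Hmono; auto. lra. }
    apply (nc_ext _ _ HN (fun s => Cminus (u (RtoC (s ^ n))) (u (RtoC 0))) _ (2 * K / rho * r)).
    - intros s _. now rewrite Hu0.
    - apply HL2. lra.
    - apply (nc_comp_lip _ _ HN u a K rho (fun s => RtoC (s ^ n)) (fun _ => RtoC 0)); auto.
      + apply (nc_ext _ _ HN (fun s => RtoC (s ^ n)) _ r); auto; lra.
      + apply (nc_ext _ _ HN (fun _ => RtoC 0) _ (Cmod (RtoC 0))); auto.
        * rewrite Cmod_0. lra.
        * apply (nc_const _ _ HN).
      + apply (nc_ext _ _ HN (fun s => RtoC (s ^ n)) _ r); auto; [|lra]. intros; ring. }
  destruct (contraction_fixed_point (fun s => newton_map m v (P s) (U s)) r eta Hr (proj1 Heta))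
    as [X [HX Xfix]].
  { intros s Hs x y Hx Hy.
    destruct (Hcontr _ _ (point_norm_class s) P U) as [Hlip _].
    - apply (nc_sup _ _ HN _ _ s HP Hs).
    - apply (nc_sup _ _ HN _ _ s HU Hs).
    - apply (Hlip (fun _ => x) (fun _ => y)); auto. lra. }
  { apply (Hcontr _ _ HN P U HP HU). }
  { apply (Hcontr _ _ HN P U HP HU). }
  assert (Hmnz : RtoC (/ INR m) <> RtoC 0).
  { intros E. apply RtoC_inj in E. assert (0 < INR m) by (apply lt_0_INR; lia).
    assert (0 < / INR m) by now apply Rinv_0_lt_compat. lra. }
  assert (Hnewton : forall s x, newton_map m v (P s) (U s) x = x <->
    Cmult (Cpow (Cplus (RtoC 1) x) m) (v (Cmult (P s) (Cplus (RtoC 1) x))) = U s).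
  { intros s x. unfold newton_map. split; intros E.
    - apply Cminus_eq_0. match goal with |- ?A = _ => set (B := A) in * end.
      assert (E' : Cmult (RtoC (/ INR m)) B = RtoC 0).
      { replace (Cmult (RtoC (/ INR m)) B)
          with (Cminus x (Cminus x (Cmult (RtoC (/ INR m)) B))) by ring. rewrite E. ring. }
      replace B with (Cdiv (Cmult (RtoC (/ INR m)) B) (RtoC (/ INR m))) by (field; auto).
      rewrite E'. field. auto.
    - rewrite E. ring. }
  (* At the parameters [s] coming from the given coincidences, [Y / rho0 - 1] is a real fixed point
     in the disk of radius [eta], so it is [X s]. These [s] accumulate at 0. *)
  assert (Xreal : forall s, Rabs s <= r -> X s = RtoC (Re (X s))).
  { apply (ps_norm_real r X eta Hr HX). intros eps Heps.
    destruct (Rmin_pos_le eps r Heps Hr) as [e1 [He1 [Ae1 Be1]]].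
    destruct (Rmin_pos_le (1/2) (eta / 4) ltac:(lra) ltac:(lra)) as [e2 [He2 [Ae2 Be2]]].
    destruct (Rmin_pos_le e1 e2 He1 He2) as [e3 [He3 [Ae3 Be3]]].
    destruct (Hres e3 He3) as (s & Y & Hs & HY & E & H1 & H2).
    destruct (ratio_near_one _ _ e3 ltac:(lra) H1 H2) as [Hnz H3].
    assert (Hsa : Rabs s = s) by (apply Rabs_right; lra).
    exists s. split; [lra|].
    assert (HZ : 0 < Y / rho0) by now apply Rdiv_lt_0_compat.
    assert (EZ : Cmult (RtoC ((Y / rho0) ^ m)) (v (RtoC (s ^ p * Y))) = u (RtoC (s ^ n))).
    { assert (Eyq : (Y / rho0) ^ m = Y ^ m * / q).
      { unfold Rdiv. rewrite Rpow_mult_distr, pow_inv, Erho0. reflexivity. }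
      assert (Hqnz : RtoC q <> RtoC 0) by (intros H; apply RtoC_inj in H; lra).
      rewrite Eyq, RtoC_mult, RtoC_inv by lra. rewrite Ec in E.
      transitivity (Cdiv (Cmult (Cmult e (RtoC (Y ^ m))) (v (RtoC (s ^ p * Y))))
        (Cmult e (RtoC q))); [field; auto|]. rewrite <- E. field. auto. }
    assert (HZ1 : Rabs (Y / rho0 - 1) <= eta).
    { eapply Rle_trans; [apply (Rabs_minus_one_le_pow _ m HZ Hm)|].
      rewrite <- Cmod_R, RtoC_minus.
      replace (RtoC ((Y / rho0) ^ m)) with (Cdiv (u (RtoC (s ^ n))) (v (RtoC (s ^ p * Y)))).
      - lra.
      - rewrite <- EZ. field. auto. }
    rewrite <- (proj2 (Xfix s ltac:(lra)) (RtoC (Y / rho0 - 1))).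
    - reflexivity.
    - rewrite Cmod_R. auto.
    - apply Hnewton. rewrite <- RtoC_plus.
      replace (1 + (Y / rho0 - 1)) with (Y / rho0) by ring.
      unfold P, U. rewrite <- RtoC_mult, <- RtoC_pow.
      replace (rho0 * s ^ p * (Y / rho0)) with (s ^ p * Y) by (field; lra). exact EZ. }
  set (W := fun s => rho0 * s ^ p * (1 + Re (X s))).
  assert (HXb : forall s, Rabs s <= r -> 1/2 <= 1 + Re (X s) <= 3/2).
  { intros s Hs. pose proof (nc_sup _ _ HN _ _ s HX Hs) as H. rewrite (Xreal s Hs), Cmod_R in H.
    apply Rabs_le_between in H. lra. }
  assert (HWeq : forall s, Rabs s <= r -> g (s ^ n) = h (W s)).
  { intros s Hs.
    assert (HWP : RtoC (W s) = Cmult (P s) (Cplus (RtoC 1) (X s))).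
    { unfold W, P. rewrite RtoC_mult, RtoC_plus, <- Xreal by auto. reflexivity. }
    rewrite Eg, Eh, E0.
    - f_equal. rewrite HWP. destruct (Xfix s Hs) as [Hfix _]. apply Hnewton in Hfix.
      change (u (RtoC (s ^ n))) with (U s). rewrite <- Hfix, Cpow_mult_l, Ec.
      unfold P at 2. rewrite <- !RtoC_pow, Rpow_mult_distr, Erho0, <- !pow_mult, Hnk, RtoC_mult.
      ring.
    - rewrite <- Cmod_R, HWP, Cmod_mult.
      pose proof (nc_sup _ _ HN _ _ s HP' Hs) as H1.
      rewrite (Xreal s Hs), <- RtoC_plus, Cmod_R.
      pose proof (HXb s Hs). rewrite (Rabs_right (1 + _)) by lra.
      pose proof (Cmod_ge_0 (P s)). nra.
    - rewrite <- RPow_abs. pose proof (Rabs_pos s). specialize (Hpow n (Rabs s) Hn ltac:(lra)). lra. }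
  exists n, r, W. split; [|split; [auto|split; [|split]]].
  (* If [n] is even then [p] is odd: [s] and [-s] give the same [s^n], while [W s > 0 > W (-s)].
     Both values lie where [h] is injective, a contradiction. *)
  - destruct (Nat.Even_or_Odd n) as [Hev|]; [exfalso|auto].
    destruct Hodd as [Ho|Ho]; [apply (Nat.Even_Odd_False n); auto|].
    destruct Ih as [d [Hd Hinj]].
    destruct (lip_small (2 * rho0) (d / 2) ltac:(lra) ltac:(lra)) as [t [Ht HLt]].
    destruct (Rmin_pos_le r t Hr Ht) as [s [Hs [As Bs]]].
    assert (Hsabs : Rabs s = s) by (apply Rabs_right; lra).
    assert (Hsabs' : Rabs (- s) = s) by (rewrite Rabs_Ropp; auto).
    assert (Heven : (- s) ^ n = s ^ n).
    { destruct Hev as [n' ->]. rewrite !pow_mult. f_equal. simpl. ring. }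
    assert (Hoddp : (- s) ^ p = - s ^ p).
    { destruct Ho as [p' ->]. rewrite Nat.add_1_r. simpl pow at 1 2.
      change ((- s) * (- s) ^ (2 * p') = - (s * s ^ (2 * p'))). rewrite !pow_mult.
      replace ((- s) ^ 2) with (s ^ 2) by (simpl; ring). ring. }
    assert (Hsp : 0 < s ^ p) by now apply pow_lt.
    assert (HW1 : 0 < W s).
    { unfold W. pose proof (HXb s ltac:(lra)). repeat apply Rmult_lt_0_compat; lra. }
    assert (HW2 : 0 < - W (- s)).
    { unfold W. rewrite Hoddp. pose proof (HXb (- s) ltac:(lra)).
      replace (- (rho0 * - s ^ p * (1 + Re (X (- s))))) with (rho0 * s ^ p * (1 + Re (X (- s)))) by ring.
      repeat apply Rmult_lt_0_compat; lra. }
    assert (Hbnd : forall z, Rabs z = s -> Rabs (W z) < d).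
    { intros z Hz. unfold W. pose proof (HXb z ltac:(lra)).
      rewrite !Rabs_mult, <- RPow_abs, Hz, (Rabs_right rho0), (Rabs_right (1 + _)) by lra.
      specialize (Hpow p s Hp ltac:(lra)). specialize (HLt s ltac:(lra)).
      assert (0 <= rho0 * s ^ p) by (apply Rmult_le_pos; lra).
      assert (rho0 * s ^ p <= rho0 * s) by (apply Rmult_le_compat_l; lra). nra. }
    assert (W s = W (- s)); [|lra].
    apply Hinj; auto. rewrite <- !HWeq by lra. now rewrite Heven.
  - unfold W. rewrite pow_i by lia. ring.
  - intros s Hs. unfold W. apply continuity_pt_mult.
    + apply continuity_pt_mult; [apply continuity_pt_const; now intros ? ?|].
      apply derivable_continuous_pt, derivable_pt_pow.
    + apply continuity_pt_plus; [apply continuity_pt_const; now intros ? ?|].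
      now apply (ps_norm_Re_continuous r X eta).
  - intros s Hs. apply HWeq. lra.
Qed.

(** * Branches of self-intersections of a real curve *)

Definition analytic_curve (f : R -> C) : Prop := forall a, germ (fun x => f (a + x)).

Definition locally_injective (f : R -> C) : Prop :=
  forall a, exists d, 0 < d /\
    forall x y, Rabs (x - a) < d -> Rabs (y - a) < d -> f x = f y -> x = y.

(* [linked f x y]: the point (x, y) is a limit of other coincidences of [f]. The diagonal is not
   excluded, which makes this an equivalence relation. *)
Definition linked (f : R -> C) (x y : R) : Prop :=
  forall eps, 0 < eps -> exists x' y',
    x' <> x /\ Rabs (x' - x) < eps /\ Rabs (y' - y) < eps /\ f x' = f y'.

(** * Compactness and connectedness on the line *)

Lemma IVT_closed q x y v : x <= y -> (forall s, x <= s <= y -> continuity_pt q s) ->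
  q x <= v <= q y -> exists z, x <= z <= y /\ q z = v.
Proof.
  intros Hxy Hc [H1 H2].
  destruct (Req_dec (q x) v) as [E|E]; [exists x; split; [lra | auto]|].
  destruct (Req_dec (q y) v) as [E'|E']; [exists y; split; [lra | auto]|].
  destruct (IVT_interv (fun s => q s - v) x y) as [z [Hz Ez]].
  - intros s Hs. apply continuity_pt_minus; auto. apply continuity_pt_const. now intros ? ?.
  - destruct Hxy as [|Hxy]; [auto|]. subst. lra.
  - lra.
  - lra.
  - exists z. split; [auto | lra].
Qed.

Lemma continuity_pt_close q s eps : continuity_pt q s -> 0 < eps ->
  exists d, 0 < d /\ forall t, Rabs (t - s) < d -> Rabs (q t - q s) < eps.
Proof.
  intros H Heps. apply continuity_pt_locally with (eps := mkposreal eps Heps) in H.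
  destruct H as [d Hd]. exists d. split; [apply cond_pos|]. intros t Ht. now apply Hd.
Qed.

(** Sequential compactness without sequences: [Q e] stands for the approximate solutions of
    precision [e]. If no point is a cluster point, each has a gauge, and compactness bounds these
    gauges below by one [d] for which [Q d] has no solution. *)
Lemma interval_cluster (Q : R -> R -> Prop) a b :
  (forall e e' y, Q e y -> e <= e' -> Q e' y) ->
  (forall e, 0 < e -> exists y, a <= y <= b /\ Q e y) ->
  exists y, a <= y <= b /\ forall e, 0 < e -> exists y', Rabs (y' - y) < e /\ Q e y'.
Proof.
  intros Hmono HQ. apply NNPP. intros Hno.
  assert (H : forall y, exists d : posreal, a <= y <= b -> forall y', Rabs (y' - y) < d -> ~ Q d y').
  { intros y. destruct (classic (a <= y <= b)) as [Hy|Hy].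
    - apply NNPP. intros Hd. apply Hno. exists y. split; [auto|]. intros e He.
      apply NNPP. intros He'. apply Hd. exists (mkposreal e He). intros _ y' Hy' HQy.
      apply He'. exists y'. auto.
    - exists (mkposreal 1 Rlt_0_1). tauto. }
  apply choice in H as [delta Hdelta].
  destruct (compactness_value_1d a b delta) as [d Hd].
  destruct (HQ d (cond_pos d)) as [y [Hy HQy]].
  apply (Hd y Hy). intros [t [Ht [Hyt Hdt]]].
  apply (Hdelta t Ht y Hyt). now apply Hmono with d.
Qed.

(** The indicator function of an open and closed set is continuous; the intermediate value theorem
    would make it take the value [1/2]. *)
Lemma clopen_full (P : R -> Prop) x0 : P x0 ->
  (forall x, P x -> exists d, 0 < d /\ forall x', Rabs (x' - x) < d -> P x') ->
  (forall x, (forall e, 0 < e -> exists x', Rabs (x' - x) < e /\ P x') -> P x) ->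
  forall x, P x.
Proof.
  intros H0 Hopen Hclosed x. apply NNPP. intros Hx.
  set (chi := fun t => if excluded_middle_informative (P t) then 1 else 0).
  assert (Hchi : continuity chi).
  { intros t. apply continuity_pt_locally. intros eps.
    assert (Hloc : exists d, 0 < d /\ forall t', Rabs (t' - t) < d -> (P t' <-> P t)).
    { destruct (classic (P t)) as [Ht|Ht].
      - destruct (Hopen t Ht) as [d [Hd Hd']]. exists d. split; [auto|].
        intros t' Ht'. split; auto.
      - apply NNPP. intros Hno. apply Ht, Hclosed. intros e He.
        apply NNPP. intros Hne. apply Hno. exists e. split; [auto|].
        intros t' Ht'. split; [|tauto]. intros HP. exfalso. apply Hne. exists t'. auto. }
    destruct Hloc as [d [Hd Hd']]. exists (mkposreal d Hd). intros t' Ht'.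
    specialize (Hd' t' Ht'). unfold chi.
    destruct (excluded_middle_informative (P t')), (excluded_middle_informative (P t));
      try tauto; rewrite Rminus_diag, Rabs_R0; apply cond_pos. }
  assert (E0 : chi x0 = 1) by (unfold chi; destruct excluded_middle_informative; tauto).
  assert (E1 : chi x = 0) by (unfold chi; destruct excluded_middle_informative; tauto).
  destruct (IVT_gen chi x0 x (1/2) Hchi) as [z [_ Hz]].
  - rewrite E0, E1, Rmin_right, Rmax_left; lra.
  - unfold chi in Hz. destruct excluded_middle_informative; lra.
Qed.

(** * The relation [linked] on a fixed curve *)

Section Curve.
Variable f : R -> C.
Hypothesis f_analytic : analytic_curve f.
Hypothesis f_injective : locally_injective f.

(** Reflections reduce an approach to a linked pair from any quadrant to the positive quadrant
    assumed by [intersection_branch]. *)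
Lemma germ_reflect a sg : sg = 1 \/ sg = -1 ->
  germ (fun x => f (a + sg * x)) /\ injective_near0 (fun x => f (a + sg * x)).
Proof.
  intros Hsg.
  assert (Habs : forall x, Rabs (sg * x) = Rabs x).
  { intros x. rewrite Rabs_mult. destruct Hsg as [-> | ->].
    - rewrite Rabs_R1. ring.
    - replace (-1) with (- (1)) by ring. rewrite Rabs_Ropp, Rabs_R1. ring. }
  split.
  - destruct (f_analytic a) as [R0 [A [HR HA]]].
    exists R0, (fun n => Cmult (A n) (Cpow (RtoC sg) n)). split; [auto|]. intros x Hx.
    eapply sums_to_ext; [|apply (HA (sg * x)); now rewrite Habs].
    intros n. cbv beta. rewrite RtoC_mult, Cpow_mult_l. ring.
  - destruct (f_injective a) as [d [Hd Hi]]. exists d. split; [auto|]. intros x y Hx Hy E.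
    assert (a + sg * x = a + sg * y).
    { apply Hi; auto.
      - replace (a + sg * x - a) with (sg * x) by ring. now rewrite Habs.
      - replace (a + sg * y - a) with (sg * y) by ring. now rewrite Habs. }
    destruct Hsg as [-> | ->]; lra.
Qed.

Lemma curve_continuous a eps : 0 < eps ->
  exists d, 0 < d /\ forall x, Rabs (x - a) < d -> Cmod (Cminus (f x) (f a)) < eps.
Proof.
  intros Heps. destruct (germ_reflect a 1 (or_introl eq_refl)) as [Hg Hi].
  destruct (germ_order _ Hg Hi) as (k & c & v & b & K & rho & Hk & Hc & Hv & Hv0 & E).
  destruct (ps_sum_tends_to_one _ _ _ _ 1 Hv Hv0 ltac:(lra)) as [d1 [Hd1 [Hd1r H1]]].
  destruct (lip_small (2 * Cmod c) (eps / 2)) as [d2 [Hd2 H2]];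
    [pose proof (Cmod_ge_0 c); lra | lra |].
  destruct (Rmin_pos_le d1 d2 Hd1 Hd2) as [d3 [Hd3 [A3 B3]]].
  destruct (Rmin_pos_le d3 1 Hd3 ltac:(lra)) as [d [Hd [A4 B4]]].
  exists d. split; [auto|]. intros x Hx.
  specialize (E (x - a) ltac:(lra)). cbv beta in E.
  replace (a + 1 * (x - a)) with x in E by ring. replace (a + 1 * 0) with a in E by ring.
  rewrite E.
  match goal with |- Cmod (Cminus (Cplus ?u ?w) ?u) < _ =>
    replace (Cminus (Cplus u w) u) with w by ring end.
  specialize (H1 (RtoC (x - a))). rewrite Cmod_R in H1. specialize (H1 ltac:(lra)).
  pose proof (Cmod_le_plus (v (RtoC (x - a))) (RtoC 1)) as Hv2. rewrite Cmod_1 in Hv2.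
  rewrite !Cmod_mult, Cmod_pow, Cmod_R.
  specialize (H2 (Rabs (x - a)) ltac:(split; [apply Rabs_pos | lra])).
  assert (Hp : Rabs (x - a) ^ k <= Rabs (x - a)).
  { destruct k as [|k]; [lia|]. simpl. pose proof (Rabs_pos (x - a)).
    assert (Rabs (x - a) ^ k <= 1) by (rewrite <- (pow1 k); apply pow_incr; lra). nra. }
  assert (0 <= Rabs (x - a) ^ k) by (apply pow_le, Rabs_pos).
  pose proof (Cmod_ge_0 c). pose proof (Cmod_ge_0 (v (RtoC (x - a)))).
  apply Rle_lt_trans with (Cmod c * Rabs (x - a) * 2); [|lra].
  apply Rmult_le_compat; try lra; [now apply Rmult_le_pos|]. now apply Rmult_le_compat_l.
Qed.

Lemma linked_eq x y : linked f x y -> f x = f y.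
Proof.
  intros H. apply Cmod_small_eq. intros eps Heps.
  destruct (curve_continuous x (eps/2) ltac:(lra)) as [d1 [Hd1 H1]].
  destruct (curve_continuous y (eps/2) ltac:(lra)) as [d2 [Hd2 H2]].
  destruct (Rmin_pos_le d1 d2 Hd1 Hd2) as [d [Hd [A B]]].
  destruct (H d Hd) as (x' & y' & _ & Hx & Hy & E).
  specialize (H1 x' ltac:(lra)). specialize (H2 y' ltac:(lra)).
  pose proof (Cmod_minus_triangle (f x) (f x') (f y)) as H3.
  rewrite E in H3 at 2. rewrite (Cmod_minus_sym (f x) (f x')) in H3. lra.
Qed.

Lemma linked_refl x : linked f x x.
Proof.
  intros eps Heps. exists (x + eps / 2), (x + eps / 2).
  replace (x + eps / 2 - x) with (eps / 2) by ring. rewrite Rabs_right by lra.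
  repeat split; lra.
Qed.

(** The definition only asks [x' <> x]. If [y' = y], then [f x' = f y = f x], against injectivity
    near [x]; so [y' <> y] holds as well. *)
Lemma linked_sym x y : linked f x y -> linked f y x.
Proof.
  intros H eps Heps. pose proof (linked_eq x y H) as Exy.
  destruct (f_injective x) as [d1 [Hd1 Hi]].
  destruct (Rmin_pos_le eps d1 Heps Hd1) as [d [Hd [A B]]].
  destruct (H d Hd) as (x' & y' & Hne & Hx & Hy & E).
  exists y', x'. repeat split; auto; try lra.
  intros ->. apply Hne. apply Hi; [lra | | congruence].
  rewrite Rminus_diag, Rabs_R0. auto.
Qed.

Lemma linked_closed x y :
  (forall eps, 0 < eps -> exists x' y', Rabs (x' - x) < eps /\ Rabs (y' - y) < eps /\ linked f x' y') ->
  linked f x y.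
Proof.
  intros H eps Heps. destruct (H (eps/2) ltac:(lra)) as (x' & y' & Hx & Hy & Hl).
  destruct (Req_dec x' x) as [->|Hne].
  - destruct (Hl (eps/2) ltac:(lra)) as (x'' & y'' & Hne & Hx' & Hy' & E).
    exists x'', y''. repeat split; auto; [lra|].
    replace (y'' - y) with ((y'' - y') + (y' - y)) by ring.
    pose proof (Rabs_triang (y'' - y') (y' - y)). lra.
  - exists x', y'. repeat split; auto; try lra. now apply linked_eq.
Qed.

(** Pigeonhole: coincidences accumulate at [(x, y)] with both coordinates changed, so one of the
    four open quadrants contains them arbitrarily close. *)
Lemma linked_signs x y : linked f x y -> exists sg tg,
  (sg = 1 \/ sg = -1) /\ (tg = 1 \/ tg = -1) /\
  forall eps, 0 < eps -> exists u v, 0 < u < eps /\ 0 < v < eps /\ f (x + sg * u) = f (y + tg * v).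
Proof.
  intros H. apply NNPP. intros Hno.
  assert (Hfail : forall sg tg, (sg = 1 \/ sg = -1) -> (tg = 1 \/ tg = -1) ->
    exists eps, 0 < eps /\ forall u v, 0 < u < eps -> 0 < v < eps ->
      f (x + sg * u) <> f (y + tg * v)).
  { intros sg tg Hs Ht. apply NNPP. intros Hn. apply Hno. exists sg, tg.
    split; [auto|]. split; [auto|]. intros eps Heps. apply NNPP. intros Hn2.
    apply Hn. exists eps. split; [auto|]. intros u v Hu Hv E. apply Hn2. exists u, v. auto. }
  destruct (Hfail 1 1) as [e1 [He1 F1]]; auto.
  destruct (Hfail 1 (-1)) as [e2 [He2 F2]]; auto.
  destruct (Hfail (-1) 1) as [e3 [He3 F3]]; auto.
  destruct (Hfail (-1) (-1)) as [e4 [He4 F4]]; auto.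
  destruct (f_injective x) as [e5 [He5 Hi]].
  destruct (Rmin_pos_le e1 e2 He1 He2) as [d1 [Hd1 [A1 B1]]].
  destruct (Rmin_pos_le e3 e4 He3 He4) as [d2 [Hd2 [A2 B2]]].
  destruct (Rmin_pos_le d1 d2 Hd1 Hd2) as [d3 [Hd3 [A3 B3]]].
  destruct (Rmin_pos_le d3 e5 Hd3 He5) as [d [Hd [A B]]].
  destruct (H d Hd) as (x' & y' & Hne & Hx & Hy & E).
  assert (Hne' : y' <> y).
  { intros ->. apply Hne. apply Hi; [lra | rewrite Rminus_diag, Rabs_R0; auto |].
    rewrite E. symmetry. now apply linked_eq. }
  apply Rabs_def2 in Hx. apply Rabs_def2 in Hy.
  destruct (Rlt_le_dec x x') as [Lx|Lx]; destruct (Rlt_le_dec y y') as [Ly|Ly].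
  - apply (F1 (x' - x) (y' - y)); try lra.
    replace (x + 1 * (x' - x)) with x' by ring. now replace (y + 1 * (y' - y)) with y' by ring.
  - apply (F2 (x' - x) (y - y')); try lra.
    replace (x + 1 * (x' - x)) with x' by ring. now replace (y + -1 * (y - y')) with y' by ring.
  - apply (F3 (x - x') (y' - y)); try lra.
    replace (x + -1 * (x - x')) with x' by ring. now replace (y + 1 * (y' - y)) with y' by ring.
  - apply (F4 (x - x') (y - y')); try lra.
    replace (x + -1 * (x - x')) with x' by ring. now replace (y + -1 * (y - y')) with y' by ring.
Qed.

Lemma pow_odd_lt n s t : Nat.Odd n -> s < t -> s ^ n < t ^ n.
Proof.
  intros [j ->] Hst.
  assert (Hopp : forall z, (- z) ^ (2 * j + 1) = - z ^ (2 * j + 1)).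
  { intros z. rewrite !pow_add, !pow_mult, !pow_1.
    replace ((- z) ^ 2) with (z ^ 2) by (simpl; ring). ring. }
  assert (Hpos : forall a b, 0 <= a -> a < b -> a ^ (2 * j + 1) < b ^ (2 * j + 1)).
  { intros a b Ha Hab. apply Rnot_le_lt. intros Hle.
    destruct Hle as [Hlt|Heq].
    - apply pow_lt_reg in Hlt; lra.
    - assert (a <> b) by lra. destruct Ha as [Ha|<-].
      + assert (0 < a ^ (2 * j)) by now apply pow_lt.
        assert (a ^ (2 * j) <= b ^ (2 * j)) by (apply pow_incr; lra).
        rewrite !pow_add, !pow_1 in Heq. nra.
      + rewrite (pow_i (2 * j + 1)) in Heq by lia.
        assert (0 < b ^ (2 * j + 1)) by (apply pow_lt; lra). lra. }
  destruct (Rle_lt_dec 0 s) as [Hs|Hs]; [auto|].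
  destruct (Rle_lt_dec t 0) as [Ht|Ht].
  - specialize (Hpos (- t) (- s)). rewrite !Hopp in Hpos. lra.
  - pose proof (Hpos 0 t ltac:(lra) Ht) as H1. pose proof (Hpos 0 (- s) ltac:(lra) ltac:(lra)) as H2.
    rewrite Hopp in H2. rewrite (pow_i (2 * j + 1)) in H1, H2 by lia. lra.
Qed.

(** All points of the branch are linked pairs, not just coincidences, because neighbouring
    parameters supply coincidences with a different first coordinate. [p] is increasing whichever
    quadrant produced the branch. *)
Lemma linked_curve x y eps : linked f x y -> 0 < eps -> exists d p q,
  0 < d /\ p 0 = x /\ q 0 = y /\ (forall s t, s < t -> p s < p t) /\
  forall s, Rabs s <= d -> continuity_pt p s /\ continuity_pt q s /\
    Rabs (p s - x) < eps /\ Rabs (q s - y) < eps /\ linked f (p s) (q s).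
Proof.
  intros H Heps. destruct (linked_signs x y H) as (sg & tg & Hsg & Htg & Hs).
  destruct (germ_reflect x sg Hsg) as [Gg Ig]. destruct (germ_reflect y tg Htg) as [Gh Ih].
  destruct (intersection_branch _ _ Gg Gh Ig Ih) as (n & r & W & Hn & Hr & HW0 & HWc & HWe); auto.
  { rewrite !Rmult_0_r, !Rplus_0_r. now apply linked_eq. }
  (* The sign moves from [p] into the parameter: as [n] is odd, [sg * (sg * s)^n = s^n]. *)
  set (p := fun s => x + s ^ n). set (q := fun s => y + tg * W (sg * s)).
  assert (Hsabs : forall s, Rabs (sg * s) = Rabs s).
  { intros s. rewrite Rabs_mult. destruct Hsg as [-> | ->].
    - rewrite Rabs_R1. ring.
    - replace (-1) with (- (1)) by ring. rewrite Rabs_Ropp, Rabs_R1. ring. }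
  assert (Hpc : forall s, continuity_pt p s).
  { intros s. apply continuity_pt_plus; [apply continuity_pt_const; now intros ? ?|].
    apply derivable_continuous_pt, derivable_pt_pow. }
  assert (Hqc : forall s, Rabs s < r -> continuity_pt q s).
  { intros s Hs1. apply continuity_pt_plus; [apply continuity_pt_const; now intros ? ?|].
    apply continuity_pt_mult; [apply continuity_pt_const; now intros ? ?|].
    apply (continuity_pt_comp (fun s => sg * s) W).
    - apply continuity_pt_mult; [apply continuity_pt_const; now intros ? ?|].
      apply derivable_continuous_pt, derivable_pt_id.
    - apply HWc. now rewrite Hsabs. }
  assert (Hn1 : (1 <= n)%nat) by (destruct Hn; lia).
  assert (Hp0 : p 0 = x) by (unfold p; rewrite pow_i by lia; ring).
  assert (Hq0 : q 0 = y) by (unfold q; rewrite Rmult_0_r, HW0; ring).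
  assert (Hpi : forall s t, s < t -> p s < p t).
  { intros s t Hst. unfold p. pose proof (pow_odd_lt n s t Hn Hst). lra. }
  assert (Hpq : forall s, Rabs s < r -> f (p s) = f (q s)).
  { intros s Hs1. unfold q. rewrite <- HWe by now rewrite Hsabs.
    unfold p. do 2 f_equal. rewrite Rpow_mult_distr.
    assert (Esg : sg * sg ^ n = 1).
    { destruct Hn as [j ->]. destruct Hsg as [-> | ->].
      - rewrite pow1. ring.
      - rewrite Nat.add_1_r, pow_1_odd. ring. }
    replace (sg * (sg ^ n * s ^ n)) with (sg * sg ^ n * s ^ n) by ring. rewrite Esg. ring. }
  destruct (continuity_pt_close p 0 eps (Hpc 0) Heps) as [d1 [Hd1 H1]].
  destruct (continuity_pt_close q 0 eps) as [d2 [Hd2 H2]];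
    [apply Hqc; now rewrite Rabs_R0 | auto |].
  destruct (Rmin_pos_le d1 d2 Hd1 Hd2) as [d3 [Hd3 [A3 B3]]].
  destruct (Rmin_pos_le d3 r Hd3 Hr) as [d [Hd [A B]]].
  exists (d / 2), p, q. split; [lra|]. do 3 (split; [auto|]).
  intros s Hsd.
  split; [auto|]. split; [apply Hqc; lra|].
  rewrite Hp0 in H1. rewrite Hq0 in H2.
  split; [apply H1; rewrite Rminus_0_r; lra|]. split; [apply H2; rewrite Rminus_0_r; lra|].
  intros e He.
  destruct (continuity_pt_close p s e (Hpc s) He) as [d4 [Hd4 H4]].
  destruct (continuity_pt_close q s e) as [d5 [Hd5 H5]]; [apply Hqc; lra | auto |].
  destruct (Rmin_pos_le d4 d5 Hd4 Hd5) as [d6 [Hd6 [A6 B6]]].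
  destruct (Rmin_pos_le d6 (r - Rabs s) Hd6 ltac:(lra)) as [d7 [Hd7 [A7 B7]]].
  assert (Hdist : Rabs (s + d7 / 2 - s) = d7 / 2).
  { replace (s + d7 / 2 - s) with (d7 / 2) by ring. apply Rabs_right. lra. }
  exists (p (s + d7 / 2)), (q (s + d7 / 2)). split; [|split; [|split]].
  - pose proof (Hpi s (s + d7 / 2) ltac:(lra)). lra.
  - apply H4. lra.
  - apply H5. lra.
  - apply Hpq. pose proof (Rabs_triang s (d7 / 2)) as Ht. rewrite (Rabs_right (d7 / 2)) in Ht by lra. lra.
Qed.

(** [p] is continuous and strictly increasing, so it covers a neighbourhood of [x]. Both
    transitivity and the openness argument rely on this. *)
Lemma linked_partner x y eps : linked f x y -> 0 < eps ->
  exists d, 0 < d /\ forall x', Rabs (x' - x) < d ->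
    exists y', Rabs (y' - y) < eps /\ linked f x' y'.
Proof.
  intros H Heps.
  destruct (linked_curve x y eps H Heps) as (d & p & q & Hd & Hp0 & Hq0 & Hpi & Hc).
  pose proof (Hpi (- d) 0 ltac:(lra)) as Hl. pose proof (Hpi 0 d Hd) as Hr.
  destruct (Rmin_pos_le (x - p (- d)) (p d - x) ltac:(lra) ltac:(lra)) as [e [He [A B]]].
  exists e. split; [auto|]. intros x' Hx'. apply Rabs_def2 in Hx'.
  destruct (IVT_closed p (- d) d x') as [s [Hs Es]]; try lra.
  { intros s Hs. apply Hc. apply Rabs_le. lra. }
  destruct (Hc s) as (_ & _ & _ & Hqs & Hls); [apply Rabs_le; lra|].
  exists (q s). rewrite <- Es. auto.
Qed.

(** Move [x] slightly and follow partners twice: the displaced point has the same image as a point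
    near [z], which is a coincidence of the required kind. *)
Lemma linked_trans x y z : linked f x y -> linked f y z -> linked f x z.
Proof.
  intros Hxy Hyz eps Heps.
  destruct (linked_partner y z eps Hyz Heps) as [d1 [Hd1 H1]].
  destruct (linked_partner x y d1 Hxy Hd1) as [d2 [Hd2 H2]].
  destruct (Rmin_pos_le d2 eps Hd2 Heps) as [d [Hd [A B]]].
  assert (Hx : Rabs (x + d / 2 - x) = d / 2).
  { replace (x + d / 2 - x) with (d / 2) by ring. apply Rabs_right. lra. }
  destruct (H2 (x + d / 2) ltac:(lra)) as [y' [Hy' L1]].
  destruct (H1 y' Hy') as [z' [Hz' L2]].
  exists (x + d / 2), z'. repeat split; try lra.
  rewrite (linked_eq _ _ L1). now apply linked_eq.
Qed.

(** Competing pairs are confined to [[a0, b0]] for compactness. The limit of almost shortest pairs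
    is linked by closedness, and local injectivity prevents it from collapsing to one point. *)
Lemma shortest_linked_pair a0 b0 : a0 < b0 -> linked f a0 b0 ->
  exists a b, a0 <= a /\ a < b /\ b <= b0 /\ linked f a b /\
    forall x y, a0 <= x -> x < y -> y <= b0 -> linked f x y -> b - a <= y - x.
Proof.
  intros Hab0 Hl0.
  (* Lengths are negated because [completeness] supplies least upper bounds; [mu] below is the
     infimum of the lengths. *)
  set (S := fun l => exists x y, a0 <= x /\ x < y /\ y <= b0 /\ linked f x y /\ l = x - y).
  destruct (completeness S) as [nu [Hub Hlub]].
  { exists 0. intros l (x & y & _ & Hxy & _ & _ & ->). lra. }
  { exists (a0 - b0), a0, b0. repeat split; auto; lra. }
  set (mu := - nu).
  assert (Hmin : forall x y, a0 <= x -> x < y -> y <= b0 -> linked f x y -> mu <= y - x).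
  { intros x y H1 H2 H3 H4. assert (x - y <= nu); [|unfold mu; lra].
    apply Hub. exists x, y. auto. }
  (* Only left ends need a cluster point [a]: the lengths tend to [mu], so the matching right ends
     approach [a + mu]. *)
  destruct (interval_cluster
    (fun e x => exists y, a0 <= x /\ x < y /\ y <= b0 /\ linked f x y /\ y - x < mu + e) a0 b0)
    as [a [Ha Hcl]].
  { intros e e' x (y & H1 & H2 & H3 & H4 & H5) Hee. exists y. repeat split; auto; lra. }
  { intros e He. apply NNPP. intros Hno.
    assert (nu <= nu - e); [|lra]. apply Hlub.
    intros l (x & y & H1 & H2 & H3 & H4 & ->). apply Rnot_lt_le. intros Hlt.
    apply Hno. exists x. split; [lra|]. exists y. repeat split; auto. unfold mu. lra. }
  assert (Hlim : linked f a (a + mu)).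
  { apply linked_closed. intros eps Heps.
    destruct (Hcl (eps/2) ltac:(lra)) as (x' & Hx' & y' & H1 & H2 & H3 & H4 & H5).
    exists x', y'. split; [lra|]. split; [|auto].
    specialize (Hmin x' y' H1 H2 H3 H4). apply Rabs_def2 in Hx'. apply Rabs_def1; lra. }
  assert (Hmu0 : 0 <= mu).
  { assert (nu <= 0); [|unfold mu; lra]. apply Hlub.
    intros l (x & y & _ & Hxy & _ & _ & ->). lra. }
  assert (Hmu : 0 < mu).
  { destruct Hmu0 as [|E]; [auto|]. exfalso.
    destruct (f_injective a) as [d [Hd Hi]].
    destruct (Hcl (d/2) ltac:(lra)) as (x' & Hx' & y' & H1 & H2 & H3 & H4 & H5).
    apply Rabs_def2 in Hx'.
    assert (x' = y'); [|lra]. apply Hi; try (apply Rabs_def1; lra). now apply linked_eq. }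
  assert (Hb : a + mu <= b0).
  { apply le_epsilon. intros eps Heps.
    destruct (Hcl eps Heps) as (x' & Hx' & y' & H1 & H2 & H3 & H4 & H5).
    specialize (Hmin x' y' H1 H2 H3 H4). apply Rabs_def2 in Hx'. lra. }
  exists a, (a + mu). repeat split; auto; try lra.
  intros x y H1 H2 H3 H4. specialize (Hmin x y H1 H2 H3 H4). lra.
Qed.

(* Minimality forces the branch through (a, b) to be increasing: moving a and b towards each other
   would produce a shorter linked pair. Hence [a, b] with its ends glued absorbs small excursions
   past either end, and the set of points linked to [a, b] is open as well as closed. *)
Lemma linked_to_interval a0 b0 : a0 < b0 -> linked f a0 b0 ->
  exists a b, a < b /\ linked f a b /\ forall x, exists y, a <= y <= b /\ linked f x y.
Proof.
  intros Hab0 Hl0.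
  destruct (shortest_linked_pair a0 b0 Hab0 Hl0) as (a & b & Ha & Hab & Hb & Hl & Hmin).
  assert (Hright : exists e, 0 < e /\ forall y', b <= y' < b + e ->
    exists y, a <= y <= b /\ linked f y' y).
  (* The bound [(b - a) / 2] keeps [p] left of the midpoint and [q] right of it. If [q d <= b], the
     pair [(p d, q d)] would lie in [[a, b]] and be shorter. *)
  { destruct (linked_curve a b ((b - a) / 2) Hl ltac:(lra))
      as (d & p & q & Hd & Hp0 & Hq0 & Hpi & Hc).
    destruct (Hc d) as (_ & _ & Hpd & Hqd & Hld); [rewrite Rabs_right; lra|].
    pose proof (Hpi 0 d Hd) as Hpd'.
    apply Rabs_def2 in Hpd. apply Rabs_def2 in Hqd.
    assert (Hqb : b < q d).
    { apply Rnot_le_lt. intros Hle.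
      specialize (Hmin (p d) (q d) ltac:(lra) ltac:(lra) ltac:(lra) Hld). lra. }
    exists (q d - b). split; [lra|]. intros y' Hy'.
    destruct (IVT_closed q 0 d y') as [s [Hs Es]]; try lra.
    { intros s Hs. apply Hc. rewrite Rabs_right; lra. }
    destruct (Hc s) as (_ & _ & Hps & _ & Hls); [rewrite Rabs_right; lra|].
    exists (p s). split.
    - apply Rabs_def2 in Hps. destruct (Req_dec s 0) as [->|Hs0]; [lra|].
      pose proof (Hpi 0 s ltac:(lra)). lra.
    - rewrite <- Es. now apply linked_sym. }
  assert (Hleft : exists e, 0 < e /\ forall y', a - e < y' <= a ->
    exists y, a <= y <= b /\ linked f y' y).
  (* The branch is taken through [(b, a)], so the monotone coordinate starts at [b]; negative
     parameters move it below [b], and minimality pushes [q] below [a]. *)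
  { destruct (linked_curve b a ((b - a) / 2) (linked_sym _ _ Hl) ltac:(lra))
      as (d & p & q & Hd & Hp0 & Hq0 & Hpi & Hc).
    destruct (Hc (- d)) as (_ & _ & Hpd & Hqd & Hld); [rewrite Rabs_Ropp, Rabs_right; lra|].
    pose proof (Hpi (- d) 0 ltac:(lra)) as Hpd'.
    apply Rabs_def2 in Hpd. apply Rabs_def2 in Hqd.
    assert (Hqa : q (- d) < a).
    { apply Rnot_le_lt. intros Hle.
      specialize (Hmin (q (- d)) (p (- d)) ltac:(lra) ltac:(lra) ltac:(lra) (linked_sym _ _ Hld)).
      lra. }
    exists (a - q (- d)). split; [lra|]. intros y' Hy'.
    destruct (IVT_closed q (- d) 0 y') as [s [Hs Es]]; try lra.
    { intros s Hs. apply Hc. apply Rabs_le. lra. }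
    destruct (Hc s) as (_ & _ & Hps & _ & Hls); [apply Rabs_le; lra|].
    exists (p s). split.
    - apply Rabs_def2 in Hps. destruct (Req_dec s 0) as [->|Hs0]; [lra|].
      pose proof (Hpi s 0 ltac:(lra)). lra.
    - rewrite <- Es. now apply linked_sym. }
  destruct Hright as [e1 [He1 Hright]]. destruct Hleft as [e2 [He2 Hleft]].
  exists a, b. split; [auto|]. split; [auto|].
  apply (clopen_full (fun x => exists y, a <= y <= b /\ linked f x y) a).
  - exists a. split; [lra | apply linked_refl].
  - intros x [y [Hy Hxy]].
    (* The partner of a nearby point may leave [[a, b]]; the excursion is short, so that partner is
       itself linked to a point of [[a, b]]. *)
    assert (He : exists e, 0 < e /\ forall y', Rabs (y' - y) < e ->
      exists y'', a <= y'' <= b /\ linked f y' y'').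
    { destruct (Rmin_pos_le e1 e2 He1 He2) as [e [He [A B]]]. exists e. split; [auto|].
      intros y' Hy'. apply Rabs_def2 in Hy'.
      destruct (Rlt_le_dec y' a); [apply Hleft; lra|].
      destruct (Rlt_le_dec b y'); [apply Hright; lra|].
      exists y'. split; [lra | apply linked_refl]. }
    destruct He as [e [He Hnear]].
    destruct (linked_partner x y e Hxy He) as [d [Hd Hpart]].
    exists d. split; [auto|]. intros x' Hx'.
    destruct (Hpart x' Hx') as [y' [Hy' L1]]. destruct (Hnear y' Hy') as [y'' [Hy'' L2]].
    exists y''. split; [auto|]. now apply linked_trans with y'.
  - intros x Hx.
    destruct (interval_cluster
      (fun e y => a <= y <= b /\ exists x', Rabs (x' - x) < e /\ linked f x' y) a b) as [y [Hy Hcl]].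
    + intros e e' y [H1 [x' [H2 H3]]] Hee. split; [auto|]. exists x'. split; [lra | auto].
    + intros e He. destruct (Hx e He) as [x' [Hx' [y [Hy Hlk]]]].
      exists y. split; [auto|]. split; [auto|]. exists x'. auto.
    + exists y. split; [auto|]. apply linked_closed. intros eps Heps.
      destruct (Hcl eps Heps) as [y' [Hy' [_ [x' [Hx' Hlk]]]]]. exists x', y'. auto.
Qed.

(** Integers are written as differences of naturals, so that a grid point is indexed by naturals
    alone and Cantor pairing can enumerate the boxes. *)
Lemma grid_dense x k : exists i j, Rabs (x - (INR i - INR j) / (INR k + 1)) <= / (INR k + 1).
Proof.
  pose proof (pos_INR k) as Hk. destruct (archimed (x * (INR k + 1))) as [H1 H2].
  set (z := up (x * (INR k + 1))) in *.
  exists (Z.to_nat z), (Z.to_nat (- z)).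
  assert (Ez : INR (Z.to_nat z) - INR (Z.to_nat (- z)) = IZR z).
  { rewrite !INR_IZR_INZ, <- minus_IZR. f_equal. lia. }
  rewrite Ez.
  replace (x - IZR z / (INR k + 1)) with ((x * (INR k + 1) - IZR z) * / (INR k + 1))
    by (field; lra).
  rewrite Rabs_mult, (Rabs_right (/ _)) by (left; apply Rinv_0_lt_compat; lra).
  rewrite <- (Rmult_1_l (/ (INR k + 1))) at 2.
  apply Rmult_le_compat_r; [left; apply Rinv_0_lt_compat; lra|]. apply Rabs_le. lra.
Qed.

(* Without linked pairs off the diagonal the set is discrete, so each of its points is the only one
   in some box of a countable family. *)
Lemma coincidences_countable : (forall a b, linked f a b -> a = b) ->
  countable_set (fun p : R * R => fst p <> snd p /\ f (fst p) = f (snd p)).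
Proof.
  intros Hno.
  set (S := fun p : R * R => fst p <> snd p /\ f (fst p) = f (snd p)).
  assert (Hiso : forall p, S p -> exists e, 0 < e /\ forall p', S p' ->
    Rabs (fst p' - fst p) < e -> Rabs (snd p' - snd p) < e -> p' = p).
  { intros [a b] [Hne E]. simpl in Hne, E.
    assert (Hnl : ~ linked f a b) by (intros H; apply Hne; auto).
    apply not_all_ex_not in Hnl as [e1 Hnl]. apply imply_to_and in Hnl as [He1 Hnl].
    (* Not being linked forces [a' = a]; then [f b' = f b] and injectivity near [b] forces
       [b' = b]. *)
    destruct (f_injective b) as [e2 [He2 Hi]].
    destruct (Rmin_pos_le e1 e2 He1 He2) as [e [He [A B]]].
    exists e. split; [auto|]. intros [a' b'] [_ E'] Ha Hb. simpl in *.
    assert (a' = a).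
    { apply NNPP. intros Ha'. apply Hnl. exists a', b'. repeat split; auto; lra. }
    subst a'. f_equal. apply Hi; [lra | rewrite Rminus_diag, Rabs_R0; auto | congruence]. }
  set (box := fun (t : nat * (nat * (nat * (nat * nat)))) (p : R * R) =>
    let '(k, (i1, (i2, (j1, j2)))) := t in
    Rabs (fst p - (INR i1 - INR i2) / (INR k + 1)) <= / (INR k + 1) /\
    Rabs (snd p - (INR j1 - INR j2) / (INR k + 1)) <= / (INR k + 1)).
  set (decode := fun n =>
    let (k, n1) := of_nat n in let (i1, n2) := of_nat n1 in
    let (i2, n3) := of_nat n2 in (k, (i1, (i2, of_nat n3)))).
  (* One point of the set is chosen per box. The default [(0, 0)] for a box that misses the set is
     harmless, since [countable_set] allows values outside it. *)
  assert (Hpick : forall n, exists p, (exists p', S p' /\ box (decode n) p') ->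
    S p /\ box (decode n) p).
  { intros n. destruct (classic (exists p', S p' /\ box (decode n) p')) as [[p Hp]|Hn].
    - exists p. auto.
    - exists (0, 0). tauto. }
  apply choice in Hpick as [pick Hpick]. exists pick. intros p Hp.
  destruct (Hiso p Hp) as [e [He Huniq]].
  (* A mesh below [e / 2] puts two points of one box within [e] of each other, so the point picked
     is [p]. *)
  destruct (archimed_cor1 (e / 2) ltac:(lra)) as [k [Hk1 Hk2]].
  destruct (grid_dense (fst p) k) as (i1 & i2 & Hi). destruct (grid_dense (snd p) k) as (j1 & j2 & Hj).
  exists (to_nat (k, to_nat (i1, to_nat (i2, to_nat (j1, j2))))).
  set (n := to_nat _).
  assert (Hdec : decode n = (k, (i1, (i2, (j1, j2))))).
  { unfold decode, n. now rewrite !cancel_of_to. }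
  destruct (Hpick n) as [HS Hbox]; [exists p; split; [auto | rewrite Hdec; now split]|].
  rewrite Hdec in Hbox. destruct Hbox as [B1 B2].
  assert (Hke : / (INR k + 1) < e / 2).
  { assert (0 < INR k) by (apply lt_0_INR; lia).
    eapply Rlt_trans; [|apply Hk1]. apply Rinv_lt_contravar; nra. }
  assert (Hclose : forall u v w d, Rabs (u - w) <= d -> Rabs (v - w) <= d -> d < e / 2 ->
    Rabs (u - v) < e).
  { intros u v w d H1 H2 H3. apply Rabs_le_between in H1. apply Rabs_le_between in H2.
    apply Rabs_def1; lra. }
  apply Huniq; auto; eapply Hclose; eauto.
Qed.

End Curve.

(** * From [F] to its restriction to the line, and conclusion *)

Lemma pow_n_Cpow (z : C) n : pow_n (K := C_AbsRing) z n = Cpow z n.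
Proof. induction n as [|n IH]; [reflexivity|]. simpl. now rewrite IH. Qed.

Lemma analytic_near_real_line_curve F :
  analytic_near_real_line F -> analytic_curve (fun t => F (RtoC t)).
Proof.
  intros [U [_ [HU HF]]] a. destruct (HF (RtoC a) (HU a)) as [r [Hr [A HA]]].
  exists r, A. split; [auto|]. intros x Hx.
  assert (E : Cminus (RtoC (a + x)) (RtoC a) = RtoC x) by (rewrite RtoC_plus; ring).
  specialize (HA (RtoC (a + x))). rewrite E, Cmod_R in HA. specialize (HA Hx).
  apply is_series_sums_to in HA. eapply sums_to_ext; [|apply HA].
  intros n. cbv beta. rewrite pow_n_Cpow.
  change (Cmult (Cpow (RtoC x) n) (A n) = Cmult (A n) (Cpow (RtoC x) n)). ring.
Qed.

Theorem theorem2 (F : C -> C) :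
  analytic_near_real_line F ->
  locally_injective_on_R F ->
  ~ countable_set (self_intersections F) ->
  is_loop (image_of_R F).
Proof.
  intros HF HI Hunc.
  set (f := fun t : R => F (RtoC t)).
  assert (Hf : analytic_curve f) by now apply analytic_near_real_line_curve.
  assert (Hi : locally_injective f).
  { intros t. destruct (HI t) as (a & b & Hab & Hinj).
    destruct (Rmin_pos_le (t - a) (b - t) ltac:(lra) ltac:(lra)) as [d [Hd [A B]]].
    exists d. split; [auto|]. intros x y Hx Hy. apply Rabs_def2 in Hx. apply Rabs_def2 in Hy.
    apply Hinj; lra. }
  assert (Hpair : exists a b, a < b /\ linked f a b).
  { apply NNPP. intros Hno. apply Hunc. apply (coincidences_countable f Hi).
    intros a b Hl. apply NNPP. intros Hne. apply Hno.
    destruct (Rlt_le_dec a b); [now exists a, b|].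
    exists b, a. split; [lra | now apply linked_sym]. }
  destruct Hpair as (a0 & b0 & Hab0 & Hl0).
  destruct (linked_to_interval f Hf Hi a0 b0 Hab0 Hl0) as (a & b & Hab & Hl & Hall).
  exists a, b, f. split; [auto|]. split; [|split].
  - intros s Hs eps Heps. destruct (curve_continuous f Hf Hi s eps Heps) as [d [Hd Hc]].
    exists d. split; auto.
  - now apply linked_eq.
  - intros w. split.
    + intros [t Ht]. destruct (Hall t) as [y [Hy Hlk]]. exists y. split; [auto|].
      rewrite <- (linked_eq f Hf Hi _ _ Hlk). exact Ht.
    + intros [s [_ Hs]]. now exists s.
Qed.
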